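(* Let $U$ be the open unit disc, $E\subset U$ a set containing infinitely many points whose closure $\overline E$ is contained in $U$, let $1\le p\le\infty$ and $R\in(0,1)$. Then there exists $\varepsilon_0>0$ such that for every $0<\varepsilon<\varepsilon_0$ there is a finite Blaschke product $B_\varepsilon(z)=\prod_{j=1}^n\frac{z-z_j}{1-\overline{z_j}z}$ whose zeros $z_1,\dots,z_n$ lie in $\overline E$, satisfying \[ \max_{|z|\le R}|B_\varepsilon(z)|\le C_p(\varepsilon,R)\le C\max_{|z|\le R}|B_\varepsilon(z)|^{1/2}, \] where $C>0$ is a constant depending only on $R$ and $p$, and moreover $\sup_{z\in E}|B_\varepsilon(z)|\le\varepsilon$.
   Context: $H^p=H^p(U)$ is the Hardy space of holomorphic $g$ on $U$ with $\|g\|_p<\infty$, where $\|g\|_p=\lim_{r\uparrow1}\left(\frac1{2\pi}\int_0^{2\pi}|g(re^{i\theta})|^pd\theta\right)^{1/p}$ for $1\le p<\infty$ and $\|g\|_\infty=\lim_{r\uparrow1}\sup_\theta|g(re^{i\theta})|$. For $\varepsilon>0$ and $R\in(0,1)$, \[ C_p(\varepsilon,R)=\sup\Big\{\sup_{|z|\le R}|g(z)| : g\in H^p,\ \|g\|_p\le1,\ |g(\zeta)|\le\varepsilon\ \forall \zeta\in E\Big\}. \] *)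

(* Defs.v *)
From Stdlib Require Import Reals List.
From Coquelicot Require Import Coquelicot.
Open Scope R_scope.

Definition in_U (z : C) : Prop := Cmod z < 1.

Definition holo_U (g : C -> C) : Prop :=
  forall z : C, in_U z -> ex_derive (K := C_AbsRing) (V := C_NormedModule) g z.

(* x ^ y for x >= 0, y > 0, with the convention 0 ^ y = 0 *)
Definition rpow (x y : R) : R := if Rlt_dec 0 x then Rpower x y else 0.

Definition polar (r t : R) : C := (r * cos t, r * sin t).

Definition valid_exp (p : Rbar) : Prop :=
  match p with Finite x => 1 <= x | p_infty => True | m_infty => False end.

Definition Mp (p : Rbar) (g : C -> C) (r : R) : R :=
  match p with
  | Finite q =>
      rpow (/ (2 * PI) * RInt (fun t => rpow (Cmod (g (polar r t))) q) 0 (2 * PI)) (/ q)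
  | _ => real (Lub_Rbar (fun x => exists t : R, x = Cmod (g (polar r t))))
  end.

Definition Hp_norm_is (p : Rbar) (g : C -> C) (l : R) : Prop :=
  filterlim (Mp p g) (at_left 1) (locally l).

Definition Hp_unit_ball (p : Rbar) (g : C -> C) : Prop :=
  holo_U g /\ exists l : R, Hp_norm_is p g l /\ l <= 1.

Definition Cp (p : Rbar) (E : C -> Prop) (eps Rr : R) : Rbar :=
  Lub_Rbar (fun x => exists g : C -> C,
    Hp_unit_ball p g /\ (forall w, E w -> Cmod (g w) <= eps) /\
    exists z : C, Cmod z <= Rr /\ x = Cmod (g z)).

Definition blaschke (zs : list C) (z : C) : C :=
  fold_right (fun a acc => Cmult ((z - a) / (1 - Cconj a * z))%C acc) 1%C zs.

(* max_{|z| <= R} |f z| (finite for continuous f) *)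
Definition max_disc (f : C -> C) (Rr : R) : R :=
  real (Lub_Rbar (fun x => exists z : C, Cmod z <= Rr /\ x = Cmod (f z))).

Definition closure_C (E : C -> Prop) (z : C) : Prop :=
  forall d : R, 0 < d -> exists w : C, E w /\ Cmod (w - z)%C < d.

Definition infinite_set (E : C -> Prop) : Prop :=
  ~ exists l : list C, forall z, E z -> In z l.

(* Main.v *)
Require Import Defs.
From Stdlib Require Import Reals List Lra Lia Classical ClassicalEpsilon Permutation.
From Coquelicot Require Import Coquelicot.
Open Scope R_scope.

(** The upper bound comes from interpolation at near-Fekete points of [E].  Let [n] be least such
    that the Blaschke product [B] of some chosen [n]-point subset of [E], whose product of
    pairwise pseudo-hyperbolic distances is at least half of the supremum, satisfies [|B| <= eps]
    on [E].  Comparing with the [n - 1] points chosen one step earlier gives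
    [|B_a a| >= eps / 4] for each zero [a] and the product [B_a] of the other factors.  If [g]
    is admissible, Lagrange interpolation of [g] by the [B_a] and the Schwarz lemma for the
    remainder yield, for [|z| <= R],
      [|g z| <= 4 sum_a |B_a z| + |B z| (4 / (1 - R)) (K_p + 4 n)].
    With [M] the maximum of [|B|] on [|z| <= R], each [|B_a|] is there at most a constant times
    [M / t + t ^ 2] for every small [t], hence much smaller than [sqrt M]: the factors [n] are
    absorbed since [M <= q ^ n], and [n] tends to infinity as [eps] tends to 0.  The resulting
    constant is [1].

    Complex analysis enters through Cauchy's formula on circles centred at 0 only, which follows
    from Goursat's subdivision argument on polar rectangles. *)

(** * Complex differentiability *)

(** The exponent 1/2 dictates the order of the extrapolation. A zero [a] may lie close to [z], so
    [B_a] cannot be bounded by dividing [B] by its factor there. A first-order correction would give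
    a multiple of [M / t + t], at best of order [sqrt M], and the [n] summands of the Lagrange
    formula would spoil it. A second difference gives [M / t + t ^ 2], at best of order [M ^ (2/3)],
    and this gain over [sqrt M] pays for any power of [n]. The constant is fixed before [E], so
    whatever depends on [E] (a disc containing it, the number of points, all thresholds) has to go
    into [eps0]. The lower bound is direct: [B] is itself a competitor, because its means on circles
    tend to 1 for every [p]. Since [E] need not be closed, the supremum of the products of distances
    need not be attained in [E]; the two factors 2 lost to this make the 4 in [eps / 4]. No boundary
    values of [g] occur. The remainder is estimated on a single circle of radius less than 1, and
    [p] enters only through a bound for the means of [|g|] on such circles. *)

Definition cderiv (f : C -> C) (z l : C) : Prop :=
  forall e : R, 0 < e -> exists d : R, 0 < d /\
  forall w : C, Cmod (w - z)%C < d ->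
    Cmod (f w - f z - l * (w - z))%C <= e * Cmod (w - z)%C.

Definition ccont (f : C -> C) (z : C) : Prop :=
  forall e : R, 0 < e -> exists d : R, 0 < d /\
  forall w : C, Cmod (w - z)%C < d -> Cmod (f w - f z)%C < e.

Definition cdiff (f : C -> C) (z : C) : Prop := exists l : C, cderiv f z l.

Lemma Cmod_sub_sym (a b : C) : Cmod (a - b)%C = Cmod (b - a)%C.
Proof. rewrite <- Cmod_opp. f_equal. ring. Qed.

Lemma Cmod_sub_le (a b : C) : Cmod (a - b)%C <= Cmod a + Cmod b.
Proof. unfold Cminus. rewrite <- (Cmod_opp b). apply Cmod_triangle. Qed.

Lemma Cmod_triangle_inv (a b : C) : Cmod a - Cmod b <= Cmod (a - b)%C.
Proof.
  assert (H : Cmod a <= Cmod (a - b)%C + Cmod b).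
  { replace a with ((a - b) + b)%C at 1 by ring. apply Cmod_triangle. }
  lra.
Qed.

Lemma Cmod_sub_trans (a b c : C) : Cmod (a - c)%C <= Cmod (a - b)%C + Cmod (b - c)%C.
Proof. replace (a - c)%C with ((a - b) + (b - c))%C by ring. apply Cmod_triangle. Qed.

Lemma Cmod_sub_0 (a b : C) : Cmod (a - b)%C = 0 -> a = b.
Proof.
  intros H. apply Cmod_eq_0 in H. replace a with ((a - b) + b)%C by ring. rewrite H. ring.
Qed.

Lemma Cminus_neq_0 (a b : C) : a <> b -> (a - b)%C <> 0%C.
Proof. intros H H0. apply H, Cmod_sub_0. rewrite H0. apply Cmod_0. Qed.

Lemma ball_C_Cmod (z w : C) (e : posreal) :
  Cmod (w - z)%C < e -> ball (M := C_UniformSpace) z e w.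
Proof. intros H. now apply C_NormedModule_mixin_compat1. Qed.

(** Translates the filter form of differentiability into the epsilon-delta form used from here on.
    The latter is free of quotients, so it also holds at [w = z]. *)
Lemma ex_derive_cdiff (f : C -> C) (z : C) :
  ex_derive (K := C_AbsRing) (V := C_NormedModule) f z <-> cdiff f z.
Proof.
  split.
  - intros [l [_ Hl]]. exists l. intros e He.
    specialize (Hl z (fun P H => H) (mkposreal e He)).
    destruct Hl as [d Hd]. exists d. split; [apply cond_pos|].
    intros w Hw.
    assert (Hb : ball (M := AbsRing_UniformSpace C_AbsRing) z d w) by exact Hw.
    specialize (Hd w Hb). simpl in Hd.
    change (Cmod (f w - f z - (w - z) * l)%C <= e * Cmod (w - z)%C) in Hd.
    replace (l * (w - z))%C with ((w - z) * l)%C by ring. exact Hd.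
  - intros [l Hl]. exists l. split.
    + apply is_linear_scal_l.
    + intros x Hx e.
      assert (Hzx : z = x).
      { apply (is_filter_lim_locally_unique (K := C_AbsRing) (V := AbsRing_NormedModule C_AbsRing)). exact Hx. }
      subst x.
      destruct (Hl e (cond_pos e)) as [d [Hd H]].
      exists (mkposreal d Hd). intros w Hw.
      change (Cmod (f w - f z - (w - z) * l)%C <= e * Cmod (w - z)%C).
      replace ((w - z) * l)%C with (l * (w - z))%C by ring.
      apply H. exact Hw.
Qed.

Lemma cdiff_ccont (f : C -> C) (z : C) : cdiff f z -> ccont f z.
Proof.
  intros [l Hl] e He.
  destruct (Hl 1 Rlt_0_1) as [d [Hd H]].
  pose proof (Cmod_ge_0 l) as Hl0.
  exists (Rmin d (e / (2 + Cmod l))). split.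
  { apply Rmin_pos; [lra|]. apply Rdiv_lt_0_compat; lra. }
  intros w Hw.
  assert (H1 := H w (Rlt_le_trans _ _ _ Hw (Rmin_l _ _))).
  assert (H2 := Rlt_le_trans _ _ _ Hw (Rmin_r _ _)).
  replace (f w - f z)%C with ((f w - f z - l * (w - z)) + l * (w - z))%C by ring.
  eapply Rle_lt_trans; [apply Cmod_triangle|]. rewrite Cmod_mult.
  apply Rle_lt_trans with ((1 + Cmod l) * Cmod (w - z)%C); [lra|].
  apply Rle_lt_trans with ((1 + Cmod l) * (e / (2 + Cmod l))).
  - apply Rmult_le_compat_l; lra.
  - replace ((1 + Cmod l) * (e / (2 + Cmod l))) with (e - e / (2 + Cmod l)) by (field; lra).
    assert (0 < e / (2 + Cmod l)) by (apply Rdiv_lt_0_compat; lra). lra.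
Qed.

Lemma cdiff_const (c z : C) : cdiff (fun _ => c) z.
Proof.
  exists 0%C. intros e He. exists 1. split; [lra|]. intros w _.
  replace (c - c - 0 * (w - z))%C with (RtoC 0) by ring. rewrite Cmod_0.
  pose proof (Cmod_ge_0 (w - z)%C). nra.
Qed.

Lemma cdiff_id (z : C) : cdiff (fun w => w) z.
Proof.
  exists 1%C. intros e He. exists 1. split; [lra|]. intros w _.
  replace (w - z - 1 * (w - z))%C with (RtoC 0) by ring. rewrite Cmod_0.
  pose proof (Cmod_ge_0 (w - z)%C). nra.
Qed.

Lemma cdiff_plus (f g : C -> C) (z : C) :
  cdiff f z -> cdiff g z -> cdiff (fun w => f w + g w)%C z.
Proof.
  intros [l Hl] [m Hm]. exists (l + m)%C. intros e He.
  destruct (Hl (e / 2) ltac:(lra)) as [d1 [Hd1 H1]].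
  destruct (Hm (e / 2) ltac:(lra)) as [d2 [Hd2 H2]].
  exists (Rmin d1 d2). split; [now apply Rmin_pos|]. intros w Hw.
  specialize (H1 w (Rlt_le_trans _ _ _ Hw (Rmin_l _ _))).
  specialize (H2 w (Rlt_le_trans _ _ _ Hw (Rmin_r _ _))).
  replace (f w + g w - (f z + g z) - (l + m) * (w - z))%C
    with ((f w - f z - l * (w - z)) + (g w - g z - m * (w - z)))%C by ring.
  eapply Rle_trans; [apply Cmod_triangle|]. lra.
Qed.

Lemma ccont_mult (f g : C -> C) (z : C) :
  ccont f z -> ccont g z -> ccont (fun w => f w * g w)%C z.
Proof.
  intros Hf Hg e He.
  pose proof (Cmod_ge_0 (f z)) as Pf. pose proof (Cmod_ge_0 (g z)) as Pg.
  set (K := 2 * (Cmod (f z) + Cmod (g z) + 1)).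
  assert (HK : 0 < K) by (unfold K; lra).
  assert (He' : 0 < Rmin 1 (e / K)).
  { apply Rmin_pos; [lra|]. now apply Rdiv_lt_0_compat. }
  destruct (Hf _ He') as [d1 [Hd1 H1]].
  destruct (Hg _ He') as [d2 [Hd2 H2]].
  exists (Rmin d1 d2). split; [now apply Rmin_pos|]. intros w Hw.
  specialize (H1 w (Rlt_le_trans _ _ _ Hw (Rmin_l _ _))).
  specialize (H2 w (Rlt_le_trans _ _ _ Hw (Rmin_r _ _))).
  replace (f w * g w - f z * g z)%C
    with ((f w - f z) * (g w - g z) + (f w - f z) * g z + f z * (g w - g z))%C by ring.
  eapply Rle_lt_trans; [apply Cmod_triangle|].
  eapply Rle_lt_trans; [apply Rplus_le_compat_r, Cmod_triangle|].
  rewrite !Cmod_mult.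
  set (a := Cmod (f w - f z)%C) in *. set (b := Cmod (g w - g z)%C) in *.
  assert (Ha : 0 <= a) by apply Cmod_ge_0. assert (Hb : 0 <= b) by apply Cmod_ge_0.
  pose proof (Rmin_l 1 (e / K)). pose proof (Rmin_r 1 (e / K)).
  set (x := e / K) in *.
  assert (Hx : e = x * K) by (unfold x; field; lra).
  rewrite Hx. assert (0 < x) by (unfold x; now apply Rdiv_lt_0_compat). unfold K. nra.
Qed.

Lemma cdiff_mult (f g : C -> C) (z : C) :
  cdiff f z -> cdiff g z -> cdiff (fun w => f w * g w)%C z.
Proof.
  intros [l Hl] [m Hm]. exists (l * g z + f z * m)%C. intros e He.
  pose proof (Cmod_ge_0 (f z)) as Pf. pose proof (Cmod_ge_0 (g z)) as Pg.
  pose proof (Cmod_ge_0 l) as Pl. pose proof (Cmod_ge_0 m) as Pm.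
  set (K := 1 + Cmod (f z) + Cmod (g z) + (Cmod l + 1)).
  assert (HK : 1 <= K) by (unfold K; lra).
  assert (He1 : 0 < Rmin 1 (e / K)).
  { apply Rmin_pos; [lra|]. apply Rdiv_lt_0_compat; lra. }
  destruct (Hl _ He1) as [d1 [Hd1 H1]].
  destruct (Hm _ He1) as [d2 [Hd2 H2]].
  assert (Hg : ccont g z) by (apply cdiff_ccont; now exists m).
  destruct (Hg _ He1) as [d3 [Hd3 H3]].
  exists (Rmin d1 (Rmin d2 d3)). split; [now repeat apply Rmin_pos|]. intros w Hw.
  assert (Hw' := Rlt_le_trans _ _ _ Hw (Rmin_r _ _)).
  specialize (H1 w (Rlt_le_trans _ _ _ Hw (Rmin_l _ _))).
  specialize (H2 w (Rlt_le_trans _ _ _ Hw' (Rmin_l _ _))).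
  specialize (H3 w (Rlt_le_trans _ _ _ Hw' (Rmin_r _ _))).
  replace (f w * g w - f z * g z - (l * g z + f z * m) * (w - z))%C
    with ((f w - f z - l * (w - z)) * (g w - g z) + (f w - f z - l * (w - z)) * g z
          + f z * (g w - g z - m * (w - z)) + l * (w - z) * (g w - g z))%C by ring.
  eapply Rle_trans; [apply Cmod_triangle|].
  eapply Rle_trans; [apply Rplus_le_compat_r, Cmod_triangle|].
  eapply Rle_trans; [apply Rplus_le_compat_r, Rplus_le_compat_r, Cmod_triangle|].
  rewrite !Cmod_mult.
  set (a := Cmod (f w - f z - l * (w - z))%C) in *.
  set (b := Cmod (g w - g z)%C) in *.
  set (c := Cmod (g w - g z - m * (w - z))%C) in *.
  set (h := Cmod (w - z)%C) in *.
  assert (Ha : 0 <= a) by apply Cmod_ge_0. assert (Hb : 0 <= b) by apply Cmod_ge_0.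
  assert (Hc : 0 <= c) by apply Cmod_ge_0. assert (Hh : 0 <= h) by apply Cmod_ge_0.
  pose proof (Rmin_l 1 (e / K)) as R1. pose proof (Rmin_r 1 (e / K)) as R2.
  set (x := Rmin 1 (e / K)) in *.
  assert (Hx : x * K <= e).
  { replace e with (e / K * K) by (field; lra). apply Rmult_le_compat_r; lra. }
  assert (a * b <= x * h) by nra.
  assert (a * Cmod (g z) <= x * h * Cmod (g z)) by nra.
  assert (Cmod (f z) * c <= Cmod (f z) * (x * h)) by nra.
  assert (Cmod l * h * b <= Cmod l * h * x).
  { apply Rmult_le_compat_l; [nra|lra]. }
  apply Rle_trans with (x * K * h); [unfold K; nra|]. nra.
Qed.

Lemma cdiff_inv (z : C) : z <> 0%C -> cdiff Cinv z.
Proof.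
  intros Hz.
  assert (Hm : 0 < Cmod z) by now apply Cmod_gt_0.
  exists (- (/ (z * z)))%C. intros e He.
  set (m := Cmod z) in *.
  exists (Rmin (m / 2) (e * (m * m * m / 2))). split.
  { apply Rmin_pos; [lra|]. apply Rmult_lt_0_compat; [lra|].
    assert (0 < m * m) by nra. assert (0 < m * m * m) by nra. lra. }
  intros w Hw.
  assert (H1 := Rlt_le_trans _ _ _ Hw (Rmin_l _ _)).
  assert (H2 := Rlt_le_trans _ _ _ Hw (Rmin_r _ _)).
  assert (Hwm : m / 2 < Cmod w).
  { pose proof (Cmod_triangle_inv z w) as T. rewrite (Cmod_sub_sym z w) in T. fold m in T. lra. }
  assert (Hw0 : w <> 0%C) by (intros E; rewrite E, Cmod_0 in Hwm; lra).
  replace (/ w - / z - - / (z * z) * (w - z))%C with ((w - z) * (w - z) / (w * z * z))%C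
    by (field; now split).
  rewrite Cmod_div by (repeat apply Cmult_neq_0; assumption).
  rewrite !Cmod_mult. fold m. set (h := Cmod (w - z)%C) in *.
  assert (Hh : 0 <= h) by apply Cmod_ge_0.
  assert (Hden : m * m * m / 2 < Cmod w * m * m).
  { assert (0 < m * m) by nra. nra. }
  assert (0 < m * m * m / 2) by (assert (0 < m * m) by nra; nra).
  apply Rmult_le_reg_r with (Cmod w * m * m); [lra|].
  unfold Rdiv. rewrite Rmult_assoc, Rinv_l, Rmult_1_r by lra.
  assert (h <= e * (Cmod w * m * m)) by nra. nra.
Qed.

Lemma cdiff_comp_inv (f : C -> C) (z : C) :
  cdiff f z -> f z <> 0%C -> cdiff (fun w => / f w)%C z.
Proof.
  intros Hf Hz. pose proof (cdiff_ccont f z Hf) as Hc.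
  destruct Hf as [l Hl]. destruct (cdiff_inv (f z) Hz) as [m Hm].
  exists (m * l)%C. intros e He.
  pose proof (Cmod_ge_0 l) as Pl. pose proof (Cmod_ge_0 m) as Pm.
  set (K := 2 + Cmod l + Cmod m).
  assert (Hx : 0 < Rmin 1 (e / K)).
  { apply Rmin_pos; [lra|]. apply Rdiv_lt_0_compat; unfold K; lra. }
  pose proof (Rmin_l 1 (e / K)) as R1. pose proof (Rmin_r 1 (e / K)) as R2.
  set (x := Rmin 1 (e / K)) in *.
  assert (HxK : x * K <= e).
  { replace e with (e / K * K) by (field; unfold K; lra). apply Rmult_le_compat_r; [unfold K; lra|exact R2]. }
  destruct (Hl x Hx) as [d1 [Hd1 H1]].
  destruct (Hm x Hx) as [d2 [Hd2 H2]].
  destruct (Hc d2 Hd2) as [d3 [Hd3 H3]].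
  exists (Rmin d1 d3). split; [now apply Rmin_pos|]. intros w Hw.
  specialize (H1 w (Rlt_le_trans _ _ _ Hw (Rmin_l _ _))).
  specialize (H3 w (Rlt_le_trans _ _ _ Hw (Rmin_r _ _))).
  specialize (H2 (f w) H3).
  replace (/ f w - / f z - m * l * (w - z))%C
    with ((/ f w - / f z - m * (f w - f z)) + m * (f w - f z - l * (w - z)))%C by ring.
  eapply Rle_trans; [apply Cmod_triangle|]. rewrite Cmod_mult.
  assert (H4 : Cmod (f w - f z)%C <= (x + Cmod l) * Cmod (w - z)%C).
  { replace (f w - f z)%C with ((f w - f z - l * (w - z)) + l * (w - z))%C by ring.
    eapply Rle_trans; [apply Cmod_triangle|]. rewrite Cmod_mult. lra. }
  set (h := Cmod (w - z)%C) in *. assert (Hh : 0 <= h) by apply Cmod_ge_0.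
  set (k := Cmod (f w - f z)%C) in *.
  set (a := Cmod (f w - f z - l * (w - z))%C) in *.
  assert (x * k <= x * ((1 + Cmod l) * h)).
  { apply Rmult_le_compat_l; [lra|]. eapply Rle_trans; [exact H4|]. nra. }
  assert (Cmod m * a <= Cmod m * (x * h)) by (apply Rmult_le_compat_l; lra).
  apply Rle_trans with (x * K * h); [unfold K; nra|]. nra.
Qed.

Lemma cdiff_minus (f g : C -> C) (z : C) :
  cdiff f z -> cdiff g z -> cdiff (fun w => f w - g w)%C z.
Proof.
  intros Hf Hg.
  destruct (cdiff_plus _ _ _ Hf (cdiff_mult _ _ _ (cdiff_const (Copp (RtoC 1)) z) Hg)) as [l Hl].
  exists l. intros e He. destruct (Hl e He) as [d [Hd H]]. exists d. split; [exact Hd|].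
  intros w Hw. specialize (H w Hw).
  replace (f w - g w - (f z - g z) - l * (w - z))%C
    with (f w + Copp (RtoC 1) * g w - (f z + Copp (RtoC 1) * g z) - l * (w - z))%C by ring. exact H.
Qed.

Lemma cdiff_div (f g : C -> C) (z : C) :
  cdiff f z -> cdiff g z -> g z <> 0%C -> cdiff (fun w => f w / g w)%C z.
Proof. intros Hf Hg Hz. apply cdiff_mult; [exact Hf|]. now apply cdiff_comp_inv. Qed.

Lemma cdiff_ext_loc (f g : C -> C) (z : C) (d : R) :
  0 < d -> (forall w, Cmod (w - z)%C < d -> f w = g w) -> cdiff f z -> cdiff g z.
Proof.
  intros Hd Hfg [l Hl]. exists l. intros e He. destruct (Hl e He) as [d' [Hd' H]].
  exists (Rmin d d'). split; [now apply Rmin_pos|]. intros w Hw.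
  rewrite <- (Hfg w (Rlt_le_trans _ _ _ Hw (Rmin_l _ _))).
  rewrite <- (Hfg z). 2:{ now replace (z - z)%C with (RtoC 0) by ring; rewrite Cmod_0. }
  apply H. exact (Rlt_le_trans _ _ _ Hw (Rmin_r _ _)).
Qed.

(** * Integrals of complex-valued functions *)

Definition rcont (h : R -> C) (t : R) : Prop :=
  forall e : R, 0 < e -> exists d : R, 0 < d /\
  forall s : R, Rabs (s - t) < d -> Cmod (h s - h t)%C < e.

Lemma rcont_continuous (h : R -> C) (t : R) :
  rcont h t -> continuous (T := R_UniformSpace) (U := C_UniformSpace) h t.
Proof.
  intros H P [e He]. destruct (H e (cond_pos e)) as [d [Hd Hh]].
  exists (mkposreal d Hd). intros s Hs. apply He, ball_C_Cmod, Hh, Hs.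
Qed.

Lemma rcont_Cmod (h : R -> C) (t : R) : rcont h t -> continuous (fun s => Cmod (h s)) t.
Proof.
  intros H P [e He]. destruct (H e (cond_pos e)) as [d [Hd Hh]].
  exists (mkposreal d Hd). intros s Hs. apply He.
  specialize (Hh s Hs).
  pose proof (Cmod_triangle_inv (h s) (h t)). pose proof (Cmod_triangle_inv (h t) (h s)) as H1.
  rewrite (Cmod_sub_sym (h t)) in H1.
  change (Rabs (Cmod (h s) - Cmod (h t)) < e). apply Rabs_def1; lra.
Qed.

Lemma rcont_comp (f : C -> C) (h : R -> C) (t : R) :
  ccont f (h t) -> rcont h t -> rcont (fun s => f (h s)) t.
Proof.
  intros Hf Hh e He. destruct (Hf e He) as [d [Hd H]].
  destruct (Hh d Hd) as [d' [Hd' H']]. exists d'. split; [exact Hd'|].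
  intros s Hs. now apply H, H'.
Qed.

Lemma rcont_lip (h : R -> C) (K t : R) :
  (forall s, Cmod (h s - h t)%C <= K * Rabs (s - t)) -> rcont h t.
Proof.
  intros H e He.
  exists (e / (Rabs K + 1)). pose proof (Rabs_pos K).
  split; [apply Rdiv_lt_0_compat; lra|]. intros s Hs.
  eapply Rle_lt_trans; [apply H|].
  apply Rle_lt_trans with (Rabs K * Rabs (s - t)).
  { apply Rmult_le_compat_r; [apply Rabs_pos|apply Rle_abs]. }
  apply Rle_lt_trans with (Rabs K * (e / (Rabs K + 1))).
  { apply Rmult_le_compat_l; lra. }
  replace (Rabs K * (e / (Rabs K + 1))) with (e - e / (Rabs K + 1)) by (field; lra).
  assert (0 < e / (Rabs K + 1)) by (apply Rdiv_lt_0_compat; lra). lra.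
Qed.

Definition cis (t : R) : C := (cos t, sin t).

Lemma Cmod_cis (t : R) : Cmod (cis t) = 1.
Proof.
  unfold Cmod, cis; simpl.
  replace (cos t * (cos t * 1) + sin t * (sin t * 1)) with (Rsqr (sin t) + Rsqr (cos t))
    by (unfold Rsqr; ring).
  rewrite sin2_cos2. apply sqrt_1.
Qed.

Lemma polar_cis (r t : R) : polar r t = (r * cis t)%C.
Proof. unfold polar, cis, Cmult, RtoC; simpl. f_equal; ring. Qed.

Lemma Cmod_polar (r t : R) : Cmod (polar r t) = Rabs r.
Proof. rewrite polar_cis, Cmod_mult, Cmod_cis, Cmod_R. ring. Qed.

Lemma polar_period (r : R) : polar r (2 * PI) = polar r 0.
Proof. unfold polar. now rewrite cos_2PI, sin_2PI, cos_0, sin_0. Qed.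

Lemma Rabs_sin_le (x : R) : Rabs (sin x) <= Rabs x.
Proof.
  assert (H : forall y, 0 <= y -> Rabs (sin y) <= y).
  { intros y Hy. destruct (Rle_lt_dec 1 y).
    - apply Rle_trans with 1; [|lra]. apply Rabs_le. pose proof (SIN_bound y). lra.
    - destruct Hy as [Hy| <-]; [|rewrite sin_0, Rabs_R0; lra].
      rewrite Rabs_right. { left. now apply sin_lt_x. }
      apply Rle_ge, sin_ge_0; [lra|]. pose proof PI2_1. lra. }
  destruct (Rle_lt_dec 0 x).
  - rewrite (Rabs_right x) by lra. now apply H.
  - rewrite <- (Ropp_involutive x), sin_neg, Rabs_Ropp, (Rabs_Ropp (- x)).
    rewrite (Rabs_right (- x)) by lra. apply H. lra.
Qed.

(** The chord has length [2 |sin ((s - t) / 2)|], which is at most the arc. *)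
Lemma cis_lip (s t : R) : Cmod (cis s - cis t)%C <= Rabs (s - t).
Proof.
  unfold Cmod, cis, Cminus, Cplus, Copp. simpl fst; simpl snd.
  apply Rsqr_incr_0_var; [|apply Rabs_pos].
  rewrite Rsqr_sqrt by (apply Rplus_le_le_0_compat; apply pow2_ge_0).
  rewrite <- Rsqr_abs.
  replace ((cos s + - cos t) ^ 2 + (sin s + - sin t) ^ 2) with (Rsqr (2 * sin ((s - t) / 2))).
  - apply Rsqr_le_abs_1. rewrite Rabs_mult, (Rabs_right 2) by lra.
    pose proof (Rabs_sin_le ((s - t) / 2)) as H.
    replace (Rabs (s - t)) with (2 * Rabs ((s - t) / 2)); [lra|].
    unfold Rdiv. rewrite Rabs_mult, (Rabs_right (/ 2)) by lra. field.
  - assert (E1 : cos s * cos t + sin s * sin t = 1 - 2 * sin ((s - t) / 2) * sin ((s - t) / 2)).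
    { rewrite <- cos_minus, <- cos_2a_sin. f_equal. field. }
    pose proof (sin2_cos2 s) as E2. pose proof (sin2_cos2 t) as E3. unfold Rsqr in *. nra.
Qed.

Lemma polar_lip (r t r' t' : R) :
  Cmod (polar r t - polar r' t')%C <= Rabs (r - r') + Rabs r' * Rabs (t - t').
Proof.
  rewrite !polar_cis.
  replace (r * cis t - r' * cis t')%C with (RtoC (r - r') * cis t + r' * (cis t - cis t'))%C
    by (rewrite RtoC_minus; ring).
  eapply Rle_trans; [apply Cmod_triangle|]. rewrite !Cmod_mult, Cmod_cis, !Cmod_R, Rmult_1_r.
  apply Rplus_le_compat_l, Rmult_le_compat_l; [apply Rabs_pos|apply cis_lip].
Qed.

Lemma rcont_polar (r t : R) : rcont (polar r) t.
Proof.
  apply rcont_lip with (Rabs r). intros s. pose proof (polar_lip r s r t) as H.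
  replace (r - r) with 0 in H by ring. rewrite Rabs_R0 in H. lra.
Qed.

Lemma rcont_radius (r t : R) : rcont (fun x => polar x t) r.
Proof.
  apply rcont_lip with 1. intros s. pose proof (polar_lip s t r t) as H.
  replace (t - t) with 0 in H by ring. rewrite Rabs_R0 in H. lra.
Qed.

Definition CI (f : R -> C) (a b : R) : C := RInt (V := C_R_CompleteNormedModule) f a b.

Definition is_CI (f : R -> C) (a b : R) (l : C) : Prop :=
  is_RInt (V := C_R_NormedModule) f a b l.

Lemma is_CI_unique (f : R -> C) (a b : R) (l : C) : is_CI f a b l -> CI f a b = l.
Proof. intros H. now apply (is_RInt_unique (V := C_R_CompleteNormedModule)). Qed.

Lemma is_CI_cont (f : R -> C) (a b : R) :
  a <= b -> (forall t, a <= t <= b -> rcont f t) -> is_CI f a b (CI f a b).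
Proof.
  intros Hab H. apply (RInt_correct (V := C_R_CompleteNormedModule)).
  apply (ex_RInt_continuous (V := C_R_CompleteNormedModule)).
  rewrite Rmin_left, Rmax_right by exact Hab.
  intros t Ht. apply rcont_continuous, H, Ht.
Qed.

Lemma is_CI_ext (f g : R -> C) (a b : R) (l : C) :
  a <= b -> (forall t, a <= t <= b -> f t = g t) -> is_CI f a b l -> is_CI g a b l.
Proof.
  intros Hab H. apply is_RInt_ext. rewrite Rmin_left, Rmax_right by exact Hab.
  intros t Ht. apply H. lra.
Qed.

Lemma is_CI_plus (f g : R -> C) (a b : R) (l m : C) :
  is_CI f a b l -> is_CI g a b m -> is_CI (fun t => f t + g t)%C a b (l + m)%C.
Proof. apply (is_RInt_plus (V := C_R_NormedModule)). Qed.

(** The integral lives in [C] as a real normed module, where only real scalars are linear for free;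
    complex ones are handled through the real and imaginary parts. *)
Lemma is_CI_scal (f : R -> C) (a b : R) (c l : C) :
  is_CI f a b l -> is_CI (fun t => c * f t)%C a b (c * l)%C.
Proof.
  intros H.
  pose proof (is_RInt_fct_extend_fst _ _ _ _ H) as H1.
  pose proof (is_RInt_fct_extend_snd _ _ _ _ H) as H2.
  destruct c as [x y], l as [u v]. simpl in H1, H2. unfold Cmult; simpl.
  apply (is_RInt_fct_extend_pair (U := R_NormedModule) (V := R_NormedModule)); simpl.
  - exact (is_RInt_minus _ _ _ _ _ _ (is_RInt_scal _ _ _ x _ H1) (is_RInt_scal _ _ _ y _ H2)).
  - exact (is_RInt_plus _ _ _ _ _ _ (is_RInt_scal _ _ _ x _ H2) (is_RInt_scal _ _ _ y _ H1)).
Qed.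

Lemma is_CI_conj (f : R -> C) (a b : R) (l : C) :
  is_CI f a b l -> is_CI (fun t => Cconj (f t)) a b (Cconj l).
Proof.
  intros H.
  pose proof (is_RInt_fct_extend_fst _ _ _ _ H) as H1.
  pose proof (is_RInt_fct_extend_snd _ _ _ _ H) as H2.
  apply (is_RInt_fct_extend_pair (U := R_NormedModule) (V := R_NormedModule)); simpl.
  - exact H1.
  - exact (is_RInt_opp _ _ _ _ H2).
Qed.

Lemma is_CI_minus (f g : R -> C) (a b : R) (l m : C) :
  is_CI f a b l -> is_CI g a b m -> is_CI (fun t => f t - g t)%C a b (l - m)%C.
Proof. apply (is_RInt_minus (V := C_R_NormedModule)). Qed.

Lemma is_CI_const (a b : R) (c : C) : is_CI (fun _ => c) a b (RtoC (b - a) * c)%C.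
Proof.
  pose proof (is_RInt_const (V := C_R_NormedModule) a b c) as H.
  replace (RtoC (b - a) * c)%C with (scal (V := C_R_NormedModule) (b - a) c); [exact H|].
  destruct c as [x y]. unfold Cmult, RtoC; simpl.
  change (((b - a) * x, (b - a) * y) = ((b - a) * x - 0 * y, (b - a) * y + 0 * x)).
  f_equal; ring.
Qed.

Lemma is_CI_chasles (f : R -> C) (a b c : R) (l m : C) :
  is_CI f a b l -> is_CI f b c m -> is_CI f a c (l + m)%C.
Proof. apply (is_RInt_Chasles (V := C_R_NormedModule)). Qed.

Lemma C_R_norm (z : C) : norm (V := C_R_NormedModule) z = Cmod z.
Proof.
  destruct z as [x y]. change (sqrt (Rabs x ^ 2 + Rabs y ^ 2) = sqrt (x ^ 2 + y ^ 2)).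
  now rewrite !pow2_abs.
Qed.

Lemma is_CI_bound (f : R -> C) (a b M : R) (l : C) :
  a <= b -> (forall t, a <= t <= b -> Cmod (f t) <= M) -> is_CI f a b l ->
  Cmod l <= (b - a) * M.
Proof.
  intros Hab H Hl. rewrite <- C_R_norm.
  apply (norm_RInt_le_const (V := C_R_NormedModule) f a b l M Hab); [|exact Hl].
  intros t Ht. rewrite C_R_norm. now apply H.
Qed.

Lemma is_CI_le (f : R -> C) (g : R -> R) (a b m : R) (l : C) :
  a <= b -> (forall t, a <= t <= b -> Cmod (f t) <= g t) -> is_CI f a b l ->
  is_RInt g a b m -> Cmod l <= m.
Proof.
  intros Hab H Hl Hm. rewrite <- C_R_norm.
  apply (norm_RInt_le (V := C_R_NormedModule) f g a b l m Hab); [|exact Hl|exact Hm].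
  intros t Ht. rewrite C_R_norm. now apply H.
Qed.

Lemma is_CI_cis (a b : R) : is_CI (fun t => Ci * cis t)%C a b (cis b - cis a)%C.
Proof.
  apply (is_RInt_fct_extend_pair (U := R_NormedModule) (V := R_NormedModule)); simpl.
  - apply is_RInt_ext with (fun t => - sin t). { intros t _. simpl. ring. }
    apply (is_RInt_derive cos (fun t => - sin t)).
    + intros t _. apply is_derive_Reals, derivable_pt_lim_cos.
    + intros t _. apply (continuous_opp (V := R_NormedModule)). apply continuity_pt_filterlim, continuity_sin.
  - apply is_RInt_ext with cos. { intros t _. simpl. ring. }
    apply (is_RInt_derive sin cos).
    + intros t _. apply is_derive_Reals, derivable_pt_lim_sin.
    + intros t _. apply continuity_pt_filterlim, continuity_cos.
Qed.

(** * Goursat's lemma on polar rectangles *)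

Lemma nested_point (x : nat -> R) (w : R) :
  0 <= w -> (forall n, x n <= x (S n) /\ x (S n) + w / 2 ^ S n <= x n + w / 2 ^ n) ->
  exists u, forall n, x n <= u <= x n + w / 2 ^ n.
Proof.
  intros Hw H.
  assert (Hp : forall n, 0 <= w / 2 ^ n).
  { intros n. apply Rmult_le_pos; [exact Hw|]. left. apply Rinv_0_lt_compat, pow_lt. lra. }
  assert (H1 : forall n k, x n <= x (n + k)%nat).
  { intros n k. induction k as [|k IH]; [rewrite Nat.add_0_r; lra|].
    rewrite Nat.add_succ_r. destruct (H (n + k)%nat). lra. }
  assert (H2 : forall n k, x (n + k)%nat + w / 2 ^ (n + k) <= x n + w / 2 ^ n).
  { intros n k. induction k as [|k IH]; [rewrite Nat.add_0_r; lra|].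
    rewrite Nat.add_succ_r. destruct (H (n + k)%nat). lra. }
  assert (H3 : forall m n, x m <= x n + w / 2 ^ n).
  { intros m n. destruct (Nat.le_ge_cases n m) as [L|L].
    - replace m with (n + (m - n))%nat by lia.
      specialize (H2 n (m - n)%nat). specialize (Hp (n + (m - n))%nat). lra.
    - replace n with (m + (n - m))%nat by lia.
      specialize (H1 m (n - m)%nat). specialize (Hp (m + (n - m))%nat). lra. }
  destruct (completeness (fun y => exists n, y = x n)) as [u [Hu1 Hu2]].
  - exists (x 0%nat + w / 2 ^ 0). intros y [m ->]. apply H3.
  - exists (x 0%nat). now exists 0%nat.
  - exists u. intros n. split.
    + apply Hu1. now exists n.
    + apply Hu2. intros y [m ->]. apply H3.
Qed.

Lemma halving_small (w d : R) : 0 < d -> exists n, w / 2 ^ n < d.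
Proof.
  intros Hd. destruct (Pow_x_infinity 2 ltac:(rewrite Rabs_right; lra) (Rabs w / d + 1)) as [n Hn].
  specialize (Hn n (Nat.le_refl n)). exists n.
  assert (H2 : 0 < 2 ^ n) by (apply pow_lt; lra).
  rewrite Rabs_right in Hn by lra.
  apply Rmult_lt_reg_r with (2 ^ n); [exact H2|].
  unfold Rdiv. rewrite Rmult_assoc, Rinv_l, Rmult_1_r by lra.
  apply Rle_lt_trans with (Rabs w); [apply Rle_abs|].
  assert (H3 : Rabs w / d < 2 ^ n) by lra.
  apply Rmult_lt_compat_l with (r := d) in H3; [|exact Hd].
  replace (d * (Rabs w / d)) with (Rabs w) in H3 by (field; lra). exact H3.
Qed.

(** Goursat's subdivision as an induction principle. If [P] fails on a rectangle, it fails on one of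
    the four quarters; the failing rectangles shrink to a point [(u, v)], where the local hypothesis
    is contradicted. *)
Lemma quarter_induction (P : R -> R -> R -> R -> Prop) (a b c d : R) :
  a <= b -> c <= d ->
  (forall a' b' c' d', a <= a' -> a' <= b' -> b' <= b -> c <= c' -> c' <= d' -> d' <= d ->
    let m := (a' + b') / 2 in let n := (c' + d') / 2 in
    P a' m c' n -> P a' m n d' -> P m b' c' n -> P m b' n d' -> P a' b' c' d') ->
  (forall u v, a <= u <= b -> c <= v <= d -> exists e, 0 < e /\
    forall a' b' c' d', a <= a' -> a' <= u <= b' -> b' <= b -> c <= c' -> c' <= v <= d' ->
      d' <= d -> b' - a' < e -> d' - c' < e -> P a' b' c' d') ->
  P a b c d.
Proof.
  intros Hab Hcd Hsplit Hloc. apply NNPP; intros HP.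
  set (w := b - a). set (h := d - c).
  assert (Hw : 0 <= w) by (unfold w; lra). assert (Hh : 0 <= h) by (unfold h; lra).
  set (bad := fun (n : nat) (p : R * R) =>
    a <= fst p /\ fst p + w / 2 ^ n <= b /\ c <= snd p /\ snd p + h / 2 ^ n <= d /\
    ~ P (fst p) (fst p + w / 2 ^ n) (snd p) (snd p + h / 2 ^ n)).
  (* The existential stands outside the implication, so that choice yields a total function [next];
     off the bad rectangles any witness does. *)
  assert (Hstep : forall n p, exists q, bad n p -> bad (S n) q /\
    fst p <= fst q /\ fst q + w / 2 ^ S n <= fst p + w / 2 ^ n /\
    snd p <= snd q /\ snd q + h / 2 ^ S n <= snd p + h / 2 ^ n).
  { intros n [x y]. destruct (classic (bad n (x, y))) as [Hb|Hb].
    2:{ exists (0, 0). intros; contradiction. }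
    destruct Hb as (B1 & B2 & B3 & B4 & B5). simpl fst in *; simpl snd in *.
    assert (Ew : w / 2 ^ n = 2 * (w / 2 ^ S n)).
    { simpl. field. apply pow_nonzero. lra. }
    assert (Eh : h / 2 ^ n = 2 * (h / 2 ^ S n)).
    { simpl. field. apply pow_nonzero. lra. }
    assert (Pw : 0 <= w / 2 ^ S n).
    { apply Rmult_le_pos; [exact Hw|]. left. apply Rinv_0_lt_compat, pow_lt. lra. }
    assert (Ph : 0 <= h / 2 ^ S n).
    { apply Rmult_le_pos; [exact Hh|]. left. apply Rinv_0_lt_compat, pow_lt. lra. }
    unfold bad.
    remember (w / 2 ^ S n) as w' eqn:Dw. remember (h / 2 ^ S n) as h' eqn:Dh.
    rewrite Ew in *. rewrite Eh in *. clear Ew Eh.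
    specialize (Hsplit x (x + 2 * w') y (y + 2 * h')
      ltac:(lra) ltac:(lra) ltac:(lra) ltac:(lra) ltac:(lra) ltac:(lra)). cbv zeta in Hsplit.
    replace ((x + (x + 2 * w')) / 2) with (x + w') in Hsplit by field.
    replace ((y + (y + 2 * h')) / 2) with (y + h') in Hsplit by field.
    destruct (classic (P x (x + w') y (y + h'))) as [Q1|Q1].
    2:{ exists (x, y); simpl; intros _. repeat split; try lra; assumption. }
    destruct (classic (P x (x + w') (y + h') (y + 2 * h'))) as [Q2|Q2].
    2:{ exists (x, y + h'); simpl; intros _.
        replace (y + h' + h') with (y + 2 * h') by ring. repeat split; try lra; assumption. }
    destruct (classic (P (x + w') (x + 2 * w') y (y + h'))) as [Q3|Q3].
    2:{ exists (x + w', y); simpl; intros _.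
        replace (x + w' + w') with (x + 2 * w') by ring. repeat split; try lra; assumption. }
    exists (x + w', y + h'); simpl; intros _.
    replace (x + w' + w') with (x + 2 * w') by ring.
    replace (y + h' + h') with (y + 2 * h') by ring. repeat split; try lra.
    intros Q4. apply B5, Hsplit; assumption. }
  set (next := fun n p => proj1_sig (constructive_indefinite_description _ (Hstep n p))).
  set (s := fix s (n : nat) : R * R := match n with O => (a, c) | S k => next k (s k) end).
  assert (Hs : forall n, bad n (s n)).
  { induction n as [|n IH].
    - unfold bad; simpl. unfold Rdiv. rewrite Rinv_1, !Rmult_1_r.
      replace (a + w) with b by (unfold w; ring). replace (c + h) with d by (unfold h; ring).
      repeat split; try lra. exact HP.
    - simpl. unfold next. destruct constructive_indefinite_description as [q Hq]; simpl.
      now apply Hq. }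
  assert (Hs' : forall n, fst (s n) <= fst (s (S n)) /\
    fst (s (S n)) + w / 2 ^ S n <= fst (s n) + w / 2 ^ n /\
    snd (s n) <= snd (s (S n)) /\ snd (s (S n)) + h / 2 ^ S n <= snd (s n) + h / 2 ^ n).
  { intros n. simpl s. unfold next. destruct constructive_indefinite_description as [q Hq].
    simpl proj1_sig. now apply Hq. }
  destruct (nested_point (fun n => fst (s n)) w Hw) as [u Hu]; [intros n; split; apply Hs'|].
  destruct (nested_point (fun n => snd (s n)) h Hh) as [v Hv]; [intros n; split; apply Hs'|].
  destruct (Hloc u v) as [e [He HPe]].
  { specialize (Hu 0%nat). simpl in Hu. unfold w in Hu. lra. }
  { specialize (Hv 0%nat). simpl in Hv. unfold h in Hv. lra. }
  destruct (halving_small (w + h) e He) as [n Hn].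
  destruct (Hs n) as (B1 & B2 & B3 & B4 & B5). apply B5.
  assert (Pw : 0 <= w / 2 ^ n).
  { apply Rmult_le_pos; [exact Hw|]. left. apply Rinv_0_lt_compat, pow_lt. lra. }
  assert (Ph : 0 <= h / 2 ^ n).
  { apply Rmult_le_pos; [exact Hh|]. left. apply Rinv_0_lt_compat, pow_lt. lra. }
  replace ((w + h) / 2 ^ n) with (w / 2 ^ n + h / 2 ^ n) in Hn by (field; apply pow_nonzero; lra).
  apply HPe; try apply Hu; try apply Hv; lra.
Qed.

(* The integral of [f z dz / z] along the boundary of the polar rectangle
   [r1 <= |z| <= r2], [t1 <= arg z <= t2]. *)
Definition polar_boundary (f : C -> C) (r1 r2 t1 t2 : R) : C :=
  (CI (fun t => Ci * (f (polar r2 t) - f (polar r1 t)))%C t1 t2 -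
   CI (fun r => / RtoC r * (f (polar r t2) - f (polar r t1)))%C r1 r2)%C.

Lemma is_CI_arc (f : C -> C) (r1 r2 t1 t2 : R) : t1 <= t2 ->
  (forall t, ccont f (polar r1 t)) -> (forall t, ccont f (polar r2 t)) ->
  is_CI (fun t => Ci * (f (polar r2 t) - f (polar r1 t)))%C t1 t2
   (CI (fun t => Ci * (f (polar r2 t) - f (polar r1 t)))%C t1 t2).
Proof.
  intros H12 H1 H2.
  assert (A1 : is_CI (fun t => f (polar r1 t)) t1 t2 (CI (fun t => f (polar r1 t)) t1 t2)).
  { apply is_CI_cont; [exact H12|]. intros t _. apply rcont_comp; [apply H1|apply rcont_polar]. }
  assert (A2 : is_CI (fun t => f (polar r2 t)) t1 t2 (CI (fun t => f (polar r2 t)) t1 t2)).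
  { apply is_CI_cont; [exact H12|]. intros t _. apply rcont_comp; [apply H2|apply rcont_polar]. }
  pose proof (is_CI_scal _ _ _ Ci _ (is_CI_minus _ _ _ _ _ _ A2 A1)) as A.
  rewrite (is_CI_unique _ _ _ _ A). exact A.
Qed.

Lemma rcont_Cinv (r : R) : 0 < r -> rcont (fun x => / RtoC x)%C r.
Proof.
  intros Hr. apply (rcont_comp Cinv RtoC).
  - apply cdiff_ccont, cdiff_inv. intros E. injection E. lra.
  - apply rcont_lip with 1. intros s. rewrite <- RtoC_minus, Cmod_R. lra.
Qed.

Lemma is_CI_ray (f : C -> C) (r1 r2 t1 t2 : R) : 0 < r1 -> r1 <= r2 ->
  (forall r t, r1 <= r <= r2 -> ccont f (polar r t)) ->
  is_CI (fun r => / RtoC r * (f (polar r t2) - f (polar r t1)))%C r1 r2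
   (CI (fun r => / RtoC r * (f (polar r t2) - f (polar r t1)))%C r1 r2).
Proof.
  intros H0 H12 H. apply is_CI_cont; [exact H12|]. intros r Hr.
  assert (B : forall t, rcont (fun x => f (polar x t)) r).
  { intros t. apply (rcont_comp f (fun x => polar x t)); [apply H, Hr|apply rcont_radius]. }
  pose proof (rcont_Cinv r ltac:(lra)) as Bi.
  intros e He.
  set (A := (/ RtoC r)%C) in *. set (D := (f (polar r t2) - f (polar r t1))%C).
  pose proof (Cmod_ge_0 A). pose proof (Cmod_ge_0 D).
  set (K := 2 * (1 + Cmod A + Cmod D)).
  assert (HK : 0 < K) by (unfold K; lra).
  assert (Hx : 0 < Rmin 1 (e / K)) by (apply Rmin_pos; [lra|now apply Rdiv_lt_0_compat]).
  pose proof (Rmin_l 1 (e / K)) as R1. pose proof (Rmin_r 1 (e / K)) as R2.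
  set (x := Rmin 1 (e / K)) in *.
  assert (HxK : x * K <= e).
  { replace e with (e / K * K) by (field; lra). apply Rmult_le_compat_r; lra. }
  destruct (Bi x Hx) as [d0 [Hd0 H0']].
  destruct (B t1 (x / 2) ltac:(lra)) as [d1 [Hd1 H1']].
  destruct (B t2 (x / 2) ltac:(lra)) as [d2 [Hd2 H2']].
  exists (Rmin d0 (Rmin d1 d2)). split; [now repeat apply Rmin_pos|]. intros s Hs.
  assert (Hs' := Rlt_le_trans _ _ _ Hs (Rmin_r _ _)).
  specialize (H0' s (Rlt_le_trans _ _ _ Hs (Rmin_l _ _))).
  specialize (H1' s (Rlt_le_trans _ _ _ Hs' (Rmin_l _ _))).
  specialize (H2' s (Rlt_le_trans _ _ _ Hs' (Rmin_r _ _))).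
  set (D' := (f (polar s t2) - f (polar s t1))%C).
  assert (HD : Cmod (D' - D)%C < x).
  { unfold D', D. replace (f (polar s t2) - f (polar s t1) - (f (polar r t2) - f (polar r t1)))%C
    with ((f (polar s t2) - f (polar r t2)) - (f (polar s t1) - f (polar r t1)))%C by ring.
    eapply Rle_lt_trans; [apply Cmod_sub_le|]. lra. }
  replace (/ RtoC s * D' - A * D)%C with ((/ RtoC s - A) * (D' - D) + (/ RtoC s - A) * D + A * (D' - D))%C by ring.
  eapply Rle_lt_trans; [apply Cmod_triangle|].
  eapply Rle_lt_trans; [apply Rplus_le_compat_r, Cmod_triangle|].
  rewrite !Cmod_mult.
  change (Cmod (/ RtoC s - A)%C < x) in H0'.
  set (p := Cmod (/ RtoC s - A)%C) in *. set (q := Cmod (D' - D)%C) in *.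
  assert (0 <= p) by apply Cmod_ge_0. assert (0 <= q) by apply Cmod_ge_0.
  unfold K in HxK.
  assert (p * q <= x * 1) by (apply Rmult_le_compat; lra).
  assert (p * Cmod D <= x * Cmod D) by (apply Rmult_le_compat_r; lra).
  assert (Cmod A * q <= Cmod A * x) by (apply Rmult_le_compat_l; lra). nra.
Qed.

Lemma polar_boundary_split_r (f : C -> C) (r1 m r2 t1 t2 : R) :
  0 < r1 -> r1 <= m -> m <= r2 -> t1 <= t2 ->
  (forall r t, r1 <= r <= r2 -> ccont f (polar r t)) ->
  polar_boundary f r1 r2 t1 t2 = (polar_boundary f r1 m t1 t2 + polar_boundary f m r2 t1 t2)%C.
Proof.
  intros H0 H1 H2 H12 Hf. unfold polar_boundary.
  pose proof (is_CI_arc f r1 m t1 t2 H12 ltac:(intros; apply Hf; lra) ltac:(intros; apply Hf; lra)) as A1.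
  pose proof (is_CI_arc f m r2 t1 t2 H12 ltac:(intros; apply Hf; lra) ltac:(intros; apply Hf; lra)) as A2.
  pose proof (is_CI_ray f r1 m t1 t2 H0 H1 ltac:(intros; apply Hf; lra)) as A3.
  pose proof (is_CI_ray f m r2 t1 t2 ltac:(lra) H2 ltac:(intros; apply Hf; lra)) as A4.
  pose proof (is_CI_chasles _ _ _ _ _ _ A3 A4) as A5. apply is_CI_unique in A5. rewrite A5.
  pose proof (is_CI_plus _ _ _ _ _ _ A1 A2) as A6.
  apply (is_CI_ext _ (fun t => Ci * (f (polar r2 t) - f (polar r1 t)))%C) in A6; [|exact H12|].
  - apply is_CI_unique in A6. rewrite A6. ring.
  - intros t _. ring.
Qed.

Lemma polar_boundary_split_t (f : C -> C) (r1 r2 t1 m t2 : R) :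
  0 < r1 -> r1 <= r2 -> t1 <= m -> m <= t2 ->
  (forall r t, r1 <= r <= r2 -> ccont f (polar r t)) ->
  polar_boundary f r1 r2 t1 t2 = (polar_boundary f r1 r2 t1 m + polar_boundary f r1 r2 m t2)%C.
Proof.
  intros H0 H1 H2 H12 Hf. unfold polar_boundary.
  pose proof (is_CI_arc f r1 r2 t1 m H2 ltac:(intros; apply Hf; lra) ltac:(intros; apply Hf; lra)) as A1.
  pose proof (is_CI_arc f r1 r2 m t2 H12 ltac:(intros; apply Hf; lra) ltac:(intros; apply Hf; lra)) as A2.
  pose proof (is_CI_ray f r1 r2 t1 m H0 H1 Hf) as A3.
  pose proof (is_CI_ray f r1 r2 m t2 H0 H1 Hf) as A4.
  pose proof (is_CI_chasles _ _ _ _ _ _ A1 A2) as A5. apply is_CI_unique in A5. rewrite A5.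
  pose proof (is_CI_plus _ _ _ _ _ _ A3 A4) as A6.
  apply (is_CI_ext _ (fun r => / RtoC r * (f (polar r t2) - f (polar r t1)))%C) in A6; [|exact H1|].
  - apply is_CI_unique in A6. rewrite A6. ring.
  - intros t _. ring.
Qed.

(* The form [(alpha + beta z) dz / z] is closed, so only the error of the linear
   approximation at [z0] contributes. *)
Lemma polar_boundary_local (f : C -> C) (z0 l : C) (e K r1 r2 t1 t2 : R) :
  0 <= e -> 0 < r1 -> r1 <= r2 -> t1 <= t2 -> 1 <= K -> / r1 <= K ->
  (forall r t, r1 <= r <= r2 -> ccont f (polar r t)) ->
  (forall r t, r1 <= r <= r2 -> t1 <= t <= t2 ->
     Cmod (f (polar r t) - f z0 - l * (polar r t - z0))%C <= e * ((r2 - r1) + (t2 - t1))) ->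
  Cmod (polar_boundary f r1 r2 t1 t2) <= 2 * K * e * ((r2 - r1) + (t2 - t1)) ^ 2.
Proof.
  intros He H0 H1 H2 HK HK' Hf Hl. unfold polar_boundary.
  set (err := fun r t => (f (polar r t) - f z0 - l * (polar r t - z0))%C).
  set (L := (r2 - r1) + (t2 - t1)) in *.
  pose proof (is_CI_arc f r1 r2 t1 t2 H2 ltac:(intros; apply Hf; lra) ltac:(intros; apply Hf; lra)) as A1.
  pose proof (is_CI_ray f r1 r2 t1 t2 H0 H1 Hf) as A2.
  set (I1 := CI _ t1 t2) in *. set (I2 := CI _ r1 r2) in *.
  pose proof (is_CI_minus _ _ _ _ _ _ A1 (is_CI_scal _ _ _ (l * RtoC (r2 - r1))%C _ (is_CI_cis t1 t2))) as B1.
  pose proof (is_CI_minus _ _ _ _ _ _ A2 (is_CI_const r1 r2 (l * (cis t2 - cis t1))%C)) as B2.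
  (* The linear part contributes the same amount to the arcs and to the rays; subtracting it from
     both leaves two integrals of errors only. *)
  replace (I1 - I2)%C with ((I1 - l * RtoC (r2 - r1) * (cis t2 - cis t1))
     - (I2 - RtoC (r2 - r1) * (l * (cis t2 - cis t1))))%C by ring.
  assert (Herr : forall r t, r1 <= r <= r2 -> t1 <= t <= t2 -> Cmod (err r t) <= e * L) by exact Hl.
  assert (HL : 0 <= e * L) by (apply Rmult_le_pos; unfold L; lra).
  apply is_CI_bound with (M := 2 * e * L) in B1; [|exact H2|].
  2:{ intros t Ht.
      replace (Ci * (f (polar r2 t) - f (polar r1 t)) - l * RtoC (r2 - r1) * (Ci * cis t))%C
        with (Ci * (err r2 t - err r1 t))%C
        by (unfold err; rewrite !polar_cis, RtoC_minus; ring).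
      rewrite Cmod_mult, Cmod_Ci, Rmult_1_l.
      eapply Rle_trans; [apply Cmod_sub_le|].
      pose proof (Herr r2 t ltac:(lra) Ht). pose proof (Herr r1 t ltac:(lra) Ht). lra. }
  apply is_CI_bound with (M := K * (2 * e * L)) in B2; [|exact H1|].
  2:{ intros r Hr.
      assert (Hr0 : RtoC r <> RtoC 0) by (intros E; injection E; lra).
      replace (/ RtoC r * (f (polar r t2) - f (polar r t1)) - l * (cis t2 - cis t1))%C
        with (/ RtoC r * (err r t2 - err r t1))%C
        by (unfold err; rewrite !polar_cis; field; exact Hr0).
      rewrite Cmod_mult, Cmod_inv, Cmod_R, Rabs_right by (try exact Hr0; lra).
      assert (/ r <= K) by (eapply Rle_trans; [|exact HK']; apply Rinv_le_contravar; lra).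
      assert (0 < / r) by (apply Rinv_0_lt_compat; lra).
      apply Rmult_le_compat; [lra|apply Cmod_ge_0|assumption|].
      eapply Rle_trans; [apply Cmod_sub_le|].
      pose proof (Herr r t2 Hr ltac:(lra)). pose proof (Herr r t1 Hr ltac:(lra)). lra. }
  eapply Rle_trans; [apply Cmod_sub_le|].
  eapply Rle_trans; [apply Rplus_le_compat; [exact B1|exact B2]|].
  replace (2 * K * e * L ^ 2) with ((t2 - t1) * (K * (2 * (e * L))) + (r2 - r1) * (K * (2 * (e * L))))
    by (unfold L; ring).
  replace (2 * e * L) with (2 * (e * L)) by ring.
  apply Rplus_le_compat_r. apply Rmult_le_compat_l; [lra|]. nra.
Qed.

(** With [r2 <= 1], two points of a polar rectangle are no further apart than the sum of its sides.
    The local estimate is then quadratic in that sum, with a coefficient [e] that is arbitrary. *)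
Lemma polar_goursat (f : C -> C) (r1 r2 t1 t2 : R) :
  0 < r1 -> r1 <= r2 -> r2 <= 1 -> t1 <= t2 ->
  (forall r t, r1 <= r <= r2 -> cdiff f (polar r t)) ->
  polar_boundary f r1 r2 t1 t2 = 0%C.
Proof.
  intros H0 H1 Hr2 H2 Hf.
  assert (Hc : forall r t, r1 <= r <= r2 -> ccont f (polar r t)).
  { intros r t Hr. apply cdiff_ccont, Hf, Hr. }
  set (K := / r1 + 1).
  assert (HK : 1 <= K) by (unfold K; assert (0 < / r1) by (apply Rinv_0_lt_compat; lra); lra).
  assert (Heps : forall e, 0 < e ->
    Cmod (polar_boundary f r1 r2 t1 t2) <= 2 * K * e * ((r2 - r1) + (t2 - t1)) ^ 2).
  { intros e He.
    (* The bound is quadratic in the sum of the sides, so each quarter is allowed exactly one fourth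
       of it and the four add up. *)
    apply (quarter_induction
      (fun a b c d => Cmod (polar_boundary f a b c d) <= 2 * K * e * ((b - a) + (d - c)) ^ 2));
      [exact H1|exact H2| |].
    - intros a b c d Ha Hab Hb Hc' Hcd Hd m n Q1 Q2 Q3 Q4.
      assert (Hm : a <= m <= b) by (unfold m; lra). assert (Hn : c <= n <= d) by (unfold n; lra).
      assert (G : forall r t, a <= r <= b -> ccont f (polar r t)) by (intros; apply Hc; lra).
      rewrite (polar_boundary_split_r f a m b c d) by (try exact G; lra).
      rewrite (polar_boundary_split_t f a m c n d) by (try (intros; apply G); lra).
      rewrite (polar_boundary_split_t f m b c n d) by (try (intros; apply G); lra).
      eapply Rle_trans; [apply Cmod_triangle|].
      eapply Rle_trans; [apply Rplus_le_compat; apply Cmod_triangle|].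
      replace (m - a) with ((b - a) / 2) in * by (unfold m; field).
      replace (b - m) with ((b - a) / 2) in * by (unfold m; field).
      replace (n - c) with ((d - c) / 2) in * by (unfold n; field).
      replace (d - n) with ((d - c) / 2) in * by (unfold n; field).
      replace ((b - a + (d - c)) ^ 2) with (4 * ((b - a) / 2 + (d - c) / 2) ^ 2) by field. nra.
    - intros u v Hu Hv. destruct (Hf u v Hu) as [l Hl].
      destruct (Hl e He) as [d [Hd Hlin]]. exists (d / 2). split; [lra|].
      intros a b c d' Ha Hua Hb Hc' Hvc Hd' Hab Hcd.
      apply polar_boundary_local with (polar u v) l; try lra.
      + apply Rle_trans with (/ r1); [apply Rinv_le_contravar; lra|unfold K; lra].
      + intros; apply Hc; lra.
      + intros r t Hr Ht.
        assert (Hdist : Cmod (polar r t - polar u v)%C <= (b - a) + (d' - c)).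
        { eapply Rle_trans; [apply polar_lip|]. rewrite (Rabs_right u) by lra.
          assert (Rabs (r - u) <= b - a) by (apply Rabs_le; lra).
          assert (Rabs (t - v) <= d' - c) by (apply Rabs_le; lra).
          pose proof (Rabs_pos (t - v)). nra. }
        eapply Rle_trans; [apply Hlin; lra|]. apply Rmult_le_compat_l; lra. }
  apply Cmod_eq_0. apply Rle_antisym; [|apply Cmod_ge_0]. apply le_epsilon. intros e He.
  rewrite Rplus_0_l.
  set (Q := 2 * K * ((r2 - r1) + (t2 - t1)) ^ 2).
  assert (HQ : 0 <= Q).
  { unfold Q. apply Rmult_le_pos; [lra|apply pow2_ge_0]. }
  eapply Rle_trans; [apply (Heps (e / (Q + 1))); apply Rdiv_lt_0_compat; lra|].
  replace (2 * K * (e / (Q + 1)) * (r2 - r1 + (t2 - t1)) ^ 2) with (Q * (e / (Q + 1)))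
    by (unfold Q; ring).
  replace (Q * (e / (Q + 1))) with (e - e / (Q + 1)) by (field; lra).
  assert (0 < e / (Q + 1)) by (apply Rdiv_lt_0_compat; lra). lra.
Qed.

(** * Cauchy's formula *)

Definition circ (f : C -> C) (r : R) : C := CI (fun t => f (polar r t)) 0 (2 * PI).

Lemma two_PI_pos : 0 < 2 * PI.
Proof. pose proof PI_RGT_0. lra. Qed.

Lemma is_CI_circ (f : C -> C) (r : R) :
  (forall t, ccont f (polar r t)) -> is_CI (fun t => f (polar r t)) 0 (2 * PI) (circ f r).
Proof.
  intros H. apply is_CI_cont; [pose proof two_PI_pos; lra|].
  intros t _. apply rcont_comp; [apply H|apply rcont_polar].
Qed.

(** Over a full turn the two rays of the polar rectangle coincide, so their contributions cancel and
    Goursat compares the two circles. *)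
Lemma circ_annulus (f : C -> C) (r1 r2 : R) :
  0 < r1 -> r1 <= r2 -> r2 <= 1 ->
  (forall z, r1 <= Cmod z <= r2 -> cdiff f z) -> circ f r1 = circ f r2.
Proof.
  intros H0 H1 H2 Hf. pose proof two_PI_pos as HP.
  assert (Hf' : forall r t, r1 <= r <= r2 -> cdiff f (polar r t)).
  { intros r t Hr. apply Hf. rewrite Cmod_polar, Rabs_right by lra. exact Hr. }
  pose proof (polar_goursat f r1 r2 0 (2 * PI) H0 H1 H2 ltac:(lra) Hf') as G.
  unfold polar_boundary in G.
  assert (A1 : is_CI (fun t => f (polar r1 t)) 0 (2 * PI) (circ f r1)).
  { apply is_CI_circ. intros t. apply cdiff_ccont, Hf'. lra. }
  assert (A2 : is_CI (fun t => f (polar r2 t)) 0 (2 * PI) (circ f r2)).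
  { apply is_CI_circ. intros t. apply cdiff_ccont, Hf'. lra. }
  pose proof (is_CI_scal _ _ _ Ci _ (is_CI_minus _ _ _ _ _ _ A2 A1)) as A.
  rewrite (is_CI_unique _ _ _ _ A) in G.
  pose proof (is_CI_const r1 r2 0%C) as B.
  apply (is_CI_ext _ (fun r => / RtoC r * (f (polar r (2 * PI)) - f (polar r 0)))%C) in B;
    [|exact H1|intros r _; rewrite polar_period; ring].
  rewrite (is_CI_unique _ _ _ _ B) in G.
  apply Cmod_sub_0. rewrite Cmod_sub_sym.
  replace (circ f r2 - circ f r1)%C with
    (- (Ci * (Ci * (circ f r2 - circ f r1) - RtoC (r2 - r1) * RtoC 0)))%C.
  - rewrite G. replace (- (Ci * 0))%C with (RtoC 0) by ring. apply Cmod_0.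
  - replace (- (Ci * (Ci * (circ f r2 - circ f r1) - RtoC (r2 - r1) * RtoC 0)))%C
      with (- (Ci * Ci) * (circ f r2 - circ f r1))%C by ring.
    replace (Ci * Ci)%C with (Copp (RtoC 1)).
    + ring.
    + unfold Ci, Cmult, Copp, RtoC; simpl. f_equal; ring.
Qed.

Lemma circ_continuous (f : C -> C) (rho r : R) :
  0 <= r < rho -> (forall z, Cmod z < rho -> ccont f z) ->
  forall e, 0 < e -> exists d, 0 < d /\ forall x, 0 <= x < rho -> Rabs (x - r) < d ->
    Cmod (circ f x - circ f r)%C <= e.
Proof.
  intros Hr Hf e He. pose proof two_PI_pos as HP.
  set (e' := e / (4 * PI)).
  assert (He' : 0 < e') by (apply Rdiv_lt_0_compat; lra).
  assert (Hd : forall t, exists d : posreal, forall x u, Rabs (x - r) < d -> Rabs (u - t) < d ->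
    Cmod (f (polar x u) - f (polar r t))%C < e').
  { intros t. destruct (Hf (polar r t)) with (e := e') as [d [Hd H]]; [|exact He'|].
    { rewrite Cmod_polar, Rabs_right; lra. }
    assert (Hd2 : 0 < d / (2 + r)) by (apply Rdiv_lt_0_compat; lra).
    exists (mkposreal _ Hd2). simpl. intros x u Hx Hu. apply H.
    eapply Rle_lt_trans; [apply polar_lip|]. rewrite (Rabs_right r) by lra.
    apply Rle_lt_trans with ((1 + r) * (d / (2 + r))).
    - assert (r * Rabs (u - t) <= r * (d / (2 + r))) by (apply Rmult_le_compat_l; lra).
      set (y := d / (2 + r)) in *. lra.
    - replace ((1 + r) * (d / (2 + r))) with (d - d / (2 + r)) by (field; lra). lra. }
  set (delta := fun t => proj1_sig (constructive_indefinite_description _ (Hd t))).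
  assert (Hdelta : forall t x u, Rabs (x - r) < delta t -> Rabs (u - t) < delta t ->
    Cmod (f (polar x u) - f (polar r t))%C < e').
  { intros t. unfold delta. now destruct constructive_indefinite_description. }
  destruct (compactness_value_1d 0 (2 * PI) delta) as [d Hd'].
  exists d. split; [apply cond_pos|]. intros x Hx Hxr.
  assert (A1 : is_CI (fun t => f (polar x t)) 0 (2 * PI) (circ f x)).
  { apply is_CI_circ. intros t. apply Hf. rewrite Cmod_polar, Rabs_right; lra. }
  assert (A2 : is_CI (fun t => f (polar r t)) 0 (2 * PI) (circ f r)).
  { apply is_CI_circ. intros t. apply Hf. rewrite Cmod_polar, Rabs_right; lra. }
  replace e with ((2 * PI - 0) * (2 * e')) by (unfold e'; field; pose proof PI_RGT_0; lra).
  refine (is_CI_bound _ _ _ _ _ _ _ (is_CI_minus _ _ _ _ _ _ A1 A2)); [lra|].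
  (* Compactness supplies the nearby centre [u] only under a double negation, hence the argument by
     contradiction. Both values are compared with the one at angle [u]. *)
  intros t Ht. apply Rnot_lt_le; intros Hc. apply (Hd' t Ht). intros [u (Hu & Htu & Hdu)].
  pose proof (Hdelta u x t ltac:(lra) Htu) as H1.
  pose proof (Hdelta u r t) as H2.
  replace (r - r) with 0 in H2 by ring. rewrite Rabs_R0 in H2.
  specialize (H2 (cond_pos _) Htu).
  pose proof (Cmod_sub_trans (f (polar x t)) (f (polar r u)) (f (polar r t))) as H3.
  rewrite (Cmod_sub_sym (f (polar r u))) in H3. lra.
Qed.

Lemma const_limit_left (phi : R -> C) (a b : R) :
  a < b -> (forall x, a < x <= b -> phi x = phi b) ->
  (forall e, 0 < e -> exists d, 0 < d /\ forall x, a < x <= b -> Rabs (x - a) < d ->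
     Cmod (phi x - phi a)%C <= e) -> phi b = phi a.
Proof.
  intros Hab Hc Hl. apply Cmod_sub_0, Rle_antisym; [|apply Cmod_ge_0].
  apply le_epsilon. intros e He. rewrite Rplus_0_l.
  destruct (Hl e He) as [d [Hd H]].
  pose proof (Rmin_l (b - a) (d / 2)). pose proof (Rmin_r (b - a) (d / 2)).
  assert (0 < Rmin (b - a) (d / 2)) by (apply Rmin_pos; lra).
  rewrite <- (Hc (a + Rmin (b - a) (d / 2))) by lra. apply H; [lra|].
  rewrite Rabs_right; lra.
Qed.

Lemma const_limit_right (phi : R -> C) (a b : R) :
  a < b -> (forall x, a <= x < b -> phi x = phi a) ->
  (forall e, 0 < e -> exists d, 0 < d /\ forall x, a <= x < b -> Rabs (x - b) < d ->
     Cmod (phi x - phi b)%C <= e) -> phi a = phi b.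
Proof.
  intros Hab Hc Hl.
  replace a with (- - a) by ring. replace b with (- - b) by ring.
  apply (const_limit_left (fun x => phi (- x)) (- b) (- a)); [lra| |].
  - intros x Hx. rewrite Ropp_involutive. apply Hc. lra.
  - intros e He. destruct (Hl e He) as [d [Hd H]]. exists d. split; [exact Hd|].
    intros x Hx Hxb. rewrite Ropp_involutive. apply H; [lra|].
    rewrite <- Rabs_Ropp. now replace (- (- x - b)) with (x - - b) by ring.
Qed.

(* The exceptional circle [|z| = s] is crossed by continuity of [circ f]; this replaces the
   removable singularity theorem for the difference quotient below. *)
Lemma mean_value (f : C -> C) (rho s r : R) :
  (forall z, Cmod z < rho -> ccont f z) ->
  (forall z, Cmod z < rho -> Cmod z <> s -> cdiff f z) ->
  0 <= r < rho -> r <= 1 -> circ f r = (RtoC (2 * PI) * f 0)%C.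
Proof.
  intros Hc Hd Hr Hr1.
  assert (H0 : circ f 0 = (RtoC (2 * PI) * f 0)%C).
  { apply is_CI_unique. apply is_CI_ext with (fun _ => f 0%C).
    - pose proof two_PI_pos. lra.
    - intros t _. f_equal. unfold polar, RtoC. f_equal; ring.
    - pose proof (is_CI_const 0 (2 * PI) (f 0%C)) as H. now rewrite Rminus_0_r in H. }
  rewrite <- H0. clear H0.
  assert (Hcont : forall b, 0 <= b < rho -> forall e, 0 < e -> exists d, 0 < d /\
    forall x, 0 <= x < rho -> Rabs (x - b) < d -> Cmod (circ f x - circ f b)%C <= e).
  { intros b Hb. now apply circ_continuous. }
  assert (Hann : forall x y, 0 < x -> x <= y -> y <= r -> s < x \/ y < s -> circ f x = circ f y).
  { intros x y Hx Hxy Hy Hs. apply circ_annulus; try lra.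
    intros z Hz. apply Hd; [lra|]. lra. }
  assert (Hin : forall b, 0 < b <= r -> b < s \/ s <= 0 -> circ f b = circ f 0).
  { intros b Hb Hs. apply const_limit_left; [lra| |].
    - intros x Hx. apply Hann; lra.
    - intros e He. destruct (Hcont 0 ltac:(lra) e He) as [d [Hd' H]]. exists d. split; [exact Hd'|].
      intros x Hx. apply H. lra. }
  destruct (Req_dec r 0) as [->|Hr0]; [reflexivity|].
  destruct (Rle_lt_dec s 0) as [Hs0|Hs0]; [apply Hin; lra|].
  destruct (Rlt_le_dec r s) as [Hs|Hs]; [apply Hin; lra|].
  assert (Hsl : circ f (s / 2) = circ f s).
  { apply const_limit_right; [lra| |].
    - intros x Hx. symmetry. apply Hann; lra.
    - intros e He. destruct (Hcont s ltac:(lra) e He) as [d [Hd' H]]. exists d. split; [exact Hd'|].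
      intros x Hx. apply H. lra. }
  rewrite <- (Hin (s / 2)) by lra. rewrite Hsl.
  destruct (Req_dec r s) as [->|Hrs]; [reflexivity|].
  apply const_limit_left; [lra| |].
  - intros x Hx. apply Hann; lra.
  - intros e He. destruct (Hcont s ltac:(lra) e He) as [d [Hd' H]]. exists d. split; [exact Hd'|].
    intros x Hx. apply H. lra.
Qed.

Lemma polar_neq (r t : R) (z : C) : Cmod z < r -> (polar r t - z)%C <> 0%C.
Proof.
  intros Hz. apply Cminus_neq_0. intros E.
  rewrite <- E, Cmod_polar in Hz. pose proof (Rle_abs r). lra.
Qed.

(** On [|w| = r] one has [r ^ 2 = w * Cconj w], so [w / (w - z)] is the conjugate of
    [k w = r ^ 2 / (r ^ 2 - Cconj z * w)]. This [k] is holomorphic on a disc larger than the circle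
    and [k 0 = 1], so the mean value property applies. *)
Lemma kernel_integral (r : R) (z : C) :
  Cmod z < r -> r <= 1 ->
  is_CI (fun t => polar r t / (polar r t - z))%C 0 (2 * PI) (RtoC (2 * PI)).
Proof.
  intros Hz Hr1. pose proof (Cmod_ge_0 z) as Hz0.
  (* A radius between [r] and the pole at [r ^ 2 / |z|], written so that [z = 0] needs no separate
     case. *)
  set (rho := 2 * r ^ 2 / (r + Cmod z)).
  assert (Hrho : r < rho).
  { unfold rho. apply Rmult_lt_reg_r with (r + Cmod z); [lra|].
    unfold Rdiv. rewrite Rmult_assoc, Rinv_l, Rmult_1_r by lra. nra. }
  assert (Hzr : Cmod z * rho < r ^ 2).
  { unfold rho. apply Rmult_lt_reg_r with (r + Cmod z); [lra|].
    replace (Cmod z * (2 * r ^ 2 / (r + Cmod z)) * (r + Cmod z)) with (Cmod z * (2 * r ^ 2))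
      by (field; lra).
    assert (0 < r ^ 2 * (r - Cmod z)) by (apply Rmult_lt_0_compat; [apply pow_lt|]; lra). lra. }
  set (k := fun w : C => (RtoC (r ^ 2) / (RtoC (r ^ 2) - Cconj z * w))%C).
  assert (Hne : forall w, Cmod w < rho -> (RtoC (r ^ 2) - Cconj z * w)%C <> 0%C).
  { intros w Hw. apply Cminus_neq_0. intros E. apply (f_equal Cmod) in E.
    rewrite Cmod_mult, Cmod_conj, Cmod_R, Rabs_right in E by (apply Rle_ge, pow2_ge_0).
    pose proof (Cmod_ge_0 w). nra. }
  assert (Hk : forall w, Cmod w < rho -> cdiff k w).
  { intros w Hw. unfold k. apply cdiff_div; [apply cdiff_const| |now apply Hne].
    apply cdiff_minus; [apply cdiff_const|]. apply cdiff_mult; [apply cdiff_const|apply cdiff_id]. }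
  assert (Hm : circ k r = RtoC (2 * PI)).
  (* The negative radius [-1] means that there is no exceptional circle. *)
  { rewrite (mean_value k rho (-1) r); [| |intros; now apply Hk|lra|lra].
    - unfold k. replace (Cconj z * 0)%C with (RtoC 0) by ring.
      replace (RtoC (r ^ 2) - RtoC 0)%C with (RtoC (r ^ 2)) by ring.
      field. intros E. injection E as E. apply (pow_nonzero r 2); [lra|exact E].
    - intros w Hw. now apply cdiff_ccont, Hk. }
  assert (A : is_CI (fun t => k (polar r t)) 0 (2 * PI) (RtoC (2 * PI))).
  { rewrite <- Hm. apply is_CI_circ. intros t. apply cdiff_ccont, Hk.
    rewrite Cmod_polar, Rabs_right; lra. }
  apply is_CI_conj in A.
  replace (Cconj (RtoC (2 * PI))) with (RtoC (2 * PI)) in A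
    by (unfold Cconj, RtoC; simpl; f_equal; ring).
  apply is_CI_ext with (3 := A); [pose proof two_PI_pos; lra|].
  intros t _. unfold k.
  assert (Hw : Cmod (polar r t) < rho) by (rewrite Cmod_polar, Rabs_right; lra).
  specialize (Hne _ Hw). pose proof (polar_neq r t z Hz) as Hne2.
  assert (Hp : polar r t <> 0%C).
  { intros E. apply (f_equal Cmod) in E. rewrite Cmod_polar, Cmod_0, Rabs_right in E; lra. }
  assert (Hpc : Cconj (polar r t) <> 0%C).
  { intros E. apply (f_equal Cmod) in E. rewrite Cmod_conj, Cmod_polar, Cmod_0, Rabs_right in E; lra. }
  assert (Er : RtoC (r ^ 2) = (polar r t * Cconj (polar r t))%C).
  { rewrite <- Cmod2_conj, Cmod_polar, Rabs_right by lra. now rewrite RtoC_pow. }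
  rewrite Cdiv_conj by exact Hne. rewrite Cminus_conj, Cmult_conj, Cconj_conj.
  replace (Cconj (RtoC (r ^ 2))) with (RtoC (r ^ 2)) by (unfold Cconj, RtoC; simpl; f_equal; ring).
  rewrite Er.
  replace (polar r t * Cconj (polar r t) - z * Cconj (polar r t))%C
    with ((polar r t - z) * Cconj (polar r t))%C by ring.
  field. now split.
Qed.

(** Write [f w = f z + (w - z) * q w]. The function [w * q w] is continuous, holomorphic off [z] and
    0 at the origin, so its mean vanishes by [mean_value] with exceptional circle [|w| = |z|]; the
    constant part is [kernel_integral]. *)
Lemma cauchy_formula (f : C -> C) (r : R) (z : C) :
  (forall w, Cmod w < 1 -> cdiff f w) -> Cmod z < r -> r < 1 ->
  is_CI (fun t => f (polar r t) * (polar r t / (polar r t - z)))%C 0 (2 * PI)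
    (RtoC (2 * PI) * f z)%C.
Proof.
  intros Hf Hz Hr. pose proof (Cmod_ge_0 z) as Hz0.
  destruct (Hf z ltac:(lra)) as [l Hl].
  set (q := fun w => if excluded_middle_informative (w = z) then l else ((f w - f z) / (w - z))%C).
  assert (Hq1 : forall w, w <> z -> q w = ((f w - f z) / (w - z))%C).
  { intros w Hw. unfold q. now destruct excluded_middle_informative. }
  assert (Hqz : q z = l).
  { unfold q. now destruct excluded_middle_informative. }
  assert (Hqc : ccont q z).
  { intros e He. destruct (Hl (e / 2) ltac:(lra)) as [d [Hd H]]. exists d. split; [exact Hd|].
    intros w Hw. rewrite Hqz.
    destruct (classic (w = z)) as [->|Hwz].
    { rewrite Hqz. replace (l - l)%C with (RtoC 0) by ring. now rewrite Cmod_0. }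
    rewrite (Hq1 w Hwz). pose proof (Cminus_neq_0 _ _ Hwz) as Hne.
    replace ((f w - f z) / (w - z) - l)%C with ((f w - f z - l * (w - z)) / (w - z))%C
      by (field; exact Hne).
    rewrite Cmod_div by exact Hne. specialize (H w Hw).
    assert (Hp : 0 < Cmod (w - z)%C) by now apply Cmod_gt_0.
    apply Rmult_lt_reg_r with (Cmod (w - z)%C); [exact Hp|].
    unfold Rdiv. rewrite Rmult_assoc, Rinv_l, Rmult_1_r by lra. nra. }
  assert (Hqd : forall w, Cmod w < 1 -> w <> z -> cdiff q w).
  { intros w Hw Hwz. pose proof (Cminus_neq_0 _ _ Hwz) as Hne.
    apply cdiff_ext_loc with (fun w => (f w - f z) / (w - z))%C (Cmod (w - z)%C).
    - now apply Cmod_gt_0.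
    - intros v Hv. symmetry. apply Hq1. intros ->.
      rewrite (Cmod_sub_sym z w) in Hv. lra.
    - apply cdiff_div; [|apply cdiff_minus; [apply cdiff_id|apply cdiff_const]|exact Hne].
      apply cdiff_minus; [now apply Hf|apply cdiff_const]. }
  assert (Hk : circ (fun w => w * q w)%C r = 0%C).
  { rewrite (mean_value (fun w => w * q w)%C 1 (Cmod z) r); [ring| | |lra|lra].
    - intros w Hw. apply ccont_mult; [apply cdiff_ccont, cdiff_id|].
      destruct (classic (w = z)) as [->|Hwz]; [exact Hqc|]. now apply cdiff_ccont, Hqd.
    - intros w Hw Hwz. apply cdiff_mult; [apply cdiff_id|]. apply Hqd; [exact Hw|].
      intros ->. now apply Hwz. }
  assert (A : is_CI (fun t => polar r t * q (polar r t))%C 0 (2 * PI) 0%C).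
  { rewrite <- Hk. apply (is_CI_circ (fun w => w * q w)%C). intros t.
    assert (Hp : Cmod (polar r t) < 1) by (rewrite Cmod_polar, Rabs_right; lra).
    apply ccont_mult; [apply cdiff_ccont, cdiff_id|].
    apply cdiff_ccont, Hqd; [exact Hp|]. intros E. apply (polar_neq r t z Hz). rewrite E. ring. }
  pose proof (is_CI_plus _ _ _ _ _ _ A (is_CI_scal _ _ _ (f z) _ (kernel_integral r z Hz ltac:(lra)))) as B.
  replace (RtoC (2 * PI) * f z)%C with (0 + f z * RtoC (2 * PI))%C by ring.
  apply is_CI_ext with (3 := B); [pose proof two_PI_pos; lra|].
  intros t _. pose proof (polar_neq r t z Hz) as Hne.
  rewrite Hq1. { field. exact Hne. }
  intros E. apply Hne. rewrite E. ring.
Qed.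

Lemma Cmod_kernel_le (r t : R) (z : C) :
  Cmod z < r -> Cmod (polar r t / (polar r t - z))%C <= r / (r - Cmod z).
Proof.
  intros Hz. pose proof (Cmod_ge_0 z) as Hz0.
  rewrite Cmod_div by now apply polar_neq. rewrite Cmod_polar, Rabs_right by lra.
  apply Rmult_le_compat_l; [lra|]. apply Rinv_le_contravar; [lra|].
  pose proof (Cmod_triangle_inv (polar r t) z) as T. rewrite Cmod_polar, Rabs_right in T; lra.
Qed.

(** * Blaschke products and the Schwarz lemma *)

Definition bfactor (a z : C) : C := ((z - a) / (1 - Cconj a * z))%C.

Lemma bfactor_den_ge (a z : C) : Cmod z <= 1 -> 1 - Cmod a <= Cmod (1 - Cconj a * z)%C.
Proof.
  intros Hz. pose proof (Cmod_triangle_inv 1 (Cconj a * z)%C) as H.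
  rewrite Cmod_1, Cmod_mult, Cmod_conj in H. pose proof (Cmod_ge_0 a). nra.
Qed.

Lemma bfactor_den_neq (a z : C) : Cmod a < 1 -> Cmod z <= 1 -> (1 - Cconj a * z)%C <> 0%C.
Proof.
  intros Ha Hz. apply Cmod_gt_0. pose proof (bfactor_den_ge a z Hz). lra.
Qed.

Lemma bfactor_den_le (a z : C) : Cmod a <= 1 -> Cmod z <= 1 -> Cmod (1 - Cconj a * z)%C <= 2.
Proof.
  intros Ha Hz. eapply Rle_trans; [apply Cmod_sub_le|]. rewrite Cmod_1, Cmod_mult, Cmod_conj.
  pose proof (Cmod_ge_0 a). pose proof (Cmod_ge_0 z). nra.
Qed.

Lemma bfactor_identity (a z : C) :
  Cmod (1 - Cconj a * z)%C ^ 2 - Cmod (z - a)%C ^ 2 = (1 - Cmod a ^ 2) * (1 - Cmod z ^ 2).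
Proof.
  rewrite !Cmod2_alt. destruct a as [a1 a2], z as [z1 z2].
  unfold Re, Im, Cconj, Cminus, Cplus, Copp, Cmult, RtoC; simpl. ring.
Qed.

Lemma Cmod_bfactor (a z : C) : Cmod a < 1 -> Cmod z <= 1 ->
  Cmod (bfactor a z) = Cmod (z - a)%C / Cmod (1 - Cconj a * z)%C.
Proof. intros Ha Hz. unfold bfactor. apply Cmod_div, bfactor_den_neq; assumption. Qed.

Lemma Cmod_bfactor_sq (a z : C) : Cmod a < 1 -> Cmod z <= 1 ->
  Cmod (bfactor a z) ^ 2 =
  1 - (1 - Cmod a ^ 2) * (1 - Cmod z ^ 2) / Cmod (1 - Cconj a * z)%C ^ 2.
Proof.
  intros Ha Hz. rewrite Cmod_bfactor, <- bfactor_identity by assumption.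
  assert (0 < Cmod (1 - Cconj a * z)%C) by now apply Cmod_gt_0, bfactor_den_neq.
  field. lra.
Qed.

Lemma bfactor_le (a z : C) (s Rr : R) : s < 1 -> Rr <= 1 -> Cmod a <= s -> Cmod z <= Rr ->
  Cmod (bfactor a z) <= sqrt (1 - (1 - s ^ 2) * (1 - Rr ^ 2) / 4).
Proof.
  intros Hs HR Ha Hz.
  pose proof (Cmod_ge_0 a) as Pa. pose proof (Cmod_ge_0 z) as Pz.
  rewrite <- (sqrt_pow2 (Cmod (bfactor a z))) by apply Cmod_ge_0.
  apply sqrt_le_1_alt. rewrite Cmod_bfactor_sq by lra.
  pose proof (bfactor_den_ge a z ltac:(lra)) as D1.
  pose proof (bfactor_den_le a z ltac:(lra) ltac:(lra)) as D2.
  set (D := Cmod (1 - Cconj a * z)%C) in *.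
  assert (HD : 0 < D ^ 2) by nra.
  assert (H1 : 1 - s ^ 2 <= 1 - Cmod a ^ 2) by nra.
  assert (H2 : 1 - Rr ^ 2 <= 1 - Cmod z ^ 2) by nra.
  assert (H3 : (1 - s ^ 2) * (1 - Rr ^ 2) <= (1 - Cmod a ^ 2) * (1 - Cmod z ^ 2)).
  { apply Rmult_le_compat; nra. }
  assert (H4 : / 4 <= / D ^ 2) by (apply Rinv_le_contravar; nra).
  assert (0 <= (1 - s ^ 2) * (1 - Rr ^ 2)) by (apply Rmult_le_pos; nra).
  assert ((1 - s ^ 2) * (1 - Rr ^ 2) / 4 <= (1 - Cmod a ^ 2) * (1 - Cmod z ^ 2) / D ^ 2).
  { apply Rmult_le_compat; lra. }
  lra.
Qed.

Lemma bfactor_le_1 (a z : C) : Cmod a < 1 -> Cmod z <= 1 -> Cmod (bfactor a z) <= 1.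
Proof.
  intros Ha Hz. eapply Rle_trans; [apply (bfactor_le a z (Cmod a) 1); lra|].
  replace (1 - (1 - Cmod a ^ 2) * (1 - 1 ^ 2) / 4) with 1 by field. rewrite sqrt_1. lra.
Qed.

Lemma bfactor_near_circle (a z : C) : Cmod a < 1 -> Cmod z <= 1 ->
  1 - Cmod (bfactor a z) <= 2 / (1 - Cmod a) ^ 2 * (1 - Cmod z).
Proof.
  intros Ha Hz.
  pose proof (Cmod_ge_0 a) as Pa. pose proof (Cmod_ge_0 z) as Pz.
  pose proof (bfactor_le_1 a z Ha Hz) as H1. pose proof (Cmod_ge_0 (bfactor a z)) as H0.
  pose proof (Cmod_bfactor_sq a z Ha Hz) as E.
  pose proof (bfactor_den_ge a z Hz) as D1.
  set (D := Cmod (1 - Cconj a * z)%C) in *.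
  apply Rle_trans with ((1 - Cmod a ^ 2) * (1 - Cmod z ^ 2) / D ^ 2); [nra|].
  replace (2 / (1 - Cmod a) ^ 2 * (1 - Cmod z)) with (2 * (1 - Cmod z) * / (1 - Cmod a) ^ 2)
    by (field; lra).
  apply Rmult_le_compat.
  - apply Rmult_le_pos; nra.
  - left. apply Rinv_0_lt_compat. nra.
  - assert (0 <= 1 - Cmod z ^ 2) by nra. assert (0 <= Cmod a ^ 2) by nra.
    apply Rle_trans with (1 * (1 - Cmod z ^ 2)); [apply Rmult_le_compat_r; lra|nra].
  - apply Rinv_le_contravar; nra.
Qed.

Lemma bfactor_ge (a z : C) : Cmod a < 1 -> Cmod z <= 1 ->
  Cmod (z - a)%C / 2 <= Cmod (bfactor a z).
Proof.
  intros Ha Hz. rewrite Cmod_bfactor by assumption.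
  pose proof (bfactor_den_ge a z Hz) as D1.
  pose proof (bfactor_den_le a z ltac:(lra) Hz) as D2.
  apply Rmult_le_compat_l; [apply Cmod_ge_0|]. apply Rinv_le_contravar; lra.
Qed.

Lemma bfactor_sym (a z : C) : Cmod a < 1 -> Cmod z < 1 ->
  Cmod (bfactor a z) = Cmod (bfactor z a).
Proof.
  intros Ha Hz. rewrite !Cmod_bfactor, (Cmod_sub_sym z a) by lra.
  rewrite <- (Cmod_conj (1 - Cconj a * z)%C), Cminus_conj, Cmult_conj, Cconj_conj.
  replace (Cconj 1) with (RtoC 1) by (unfold Cconj, RtoC; simpl; f_equal; ring).
  now rewrite (Cmult_comm a).
Qed.

Lemma bfactor_cdiff (a z : C) : Cmod a < 1 -> Cmod z <= 1 -> cdiff (bfactor a) z.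
Proof.
  intros Ha Hz. unfold bfactor. apply cdiff_div; [| |now apply bfactor_den_neq].
  - apply cdiff_minus; [apply cdiff_id|apply cdiff_const].
  - apply cdiff_minus; [apply cdiff_const|].
    apply cdiff_mult; [apply cdiff_const|apply cdiff_id].
Qed.

Lemma blaschke_cons (a : C) (zs : list C) (z : C) :
  blaschke (a :: zs) z = (bfactor a z * blaschke zs z)%C.
Proof. reflexivity. Qed.

Lemma blaschke_perm (l l' : list C) (z : C) : Permutation l l' -> blaschke l z = blaschke l' z.
Proof.
  induction 1 as [|x l l' _ IH|x y l|l l' l'' _ IH1 _ IH2];
    rewrite ?blaschke_cons; [reflexivity|now rewrite IH|ring|now rewrite IH1].
Qed.

Lemma blaschke_cdiff (zs : list C) (z : C) :
  List.Forall (fun a => Cmod a < 1) zs -> Cmod z <= 1 -> cdiff (blaschke zs) z.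
Proof.
  intros H Hz. induction H as [|a zs Ha _ IH]; [apply cdiff_const|].
  exact (cdiff_mult _ _ _ (bfactor_cdiff a z Ha Hz) IH).
Qed.

Lemma blaschke_le_1 (zs : list C) (z : C) :
  List.Forall (fun a => Cmod a < 1) zs -> Cmod z <= 1 -> Cmod (blaschke zs z) <= 1.
Proof.
  intros H Hz. induction H as [|a zs Ha _ IH]; [simpl; rewrite Cmod_1; lra|].
  rewrite blaschke_cons, Cmod_mult.
  pose proof (bfactor_le_1 a z Ha Hz). pose proof (Cmod_ge_0 (bfactor a z)).
  pose proof (Cmod_ge_0 (blaschke zs z)). nra.
Qed.

Lemma blaschke_le_pow (zs : list C) (z : C) (w : R) :
  (forall a, In a zs -> Cmod (bfactor a z) <= w) -> Cmod (blaschke zs z) <= w ^ length zs.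
Proof.
  induction zs as [|a zs IH]; intros H; [simpl; rewrite Cmod_1; lra|].
  rewrite blaschke_cons, Cmod_mult. simpl. apply Rmult_le_compat; try apply Cmod_ge_0.
  - apply H. now left.
  - apply IH. intros b Hb. apply H. now right.
Qed.

(** Linear rate at which the modulus tends to 1, obtained from [1 - x y <= (1 - x) + (1 - y)] for
    [x], [y] in [[0, 1]]. It yields both the unit norm of the product and a lower bound for it on
    circles close to the boundary. *)
Lemma blaschke_near_circle (zs : list C) : List.Forall (fun a => Cmod a < 1) zs ->
  exists c, 0 <= c /\ forall z, Cmod z <= 1 -> 1 - Cmod (blaschke zs z) <= c * (1 - Cmod z).
Proof.
  induction 1 as [|a zs Ha H [c [Hc IH]]].
  - exists 0. split; [lra|]. intros z Hz. simpl. rewrite Cmod_1. lra.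
  - exists (2 / (1 - Cmod a) ^ 2 + c). split.
    + assert (0 < 2 / (1 - Cmod a) ^ 2) by (apply Rdiv_lt_0_compat; [|apply pow_lt]; lra). lra.
    + intros z Hz. specialize (IH z Hz). rewrite blaschke_cons, Cmod_mult.
      pose proof (bfactor_near_circle a z Ha Hz). pose proof (bfactor_le_1 a z Ha Hz).
      pose proof (Cmod_ge_0 (bfactor a z)). pose proof (blaschke_le_1 zs z H Hz). nra.
Qed.

Lemma blaschke_eq_0 (zs : list C) (z : C) : List.Forall (fun a => Cmod a < 1) zs -> Cmod z <= 1 ->
  (blaschke zs z = 0%C <-> In z zs).
Proof.
  intros H Hz. induction H as [|a zs Ha _ IH].
  - simpl. split; [|intros []]. intros E. injection E. lra.
  - rewrite blaschke_cons. split.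
    + intros E. destruct (classic (z = a)) as [->|Hza]; [now left|right].
      apply IH. apply NNPP; intros Hb. revert E. apply Cmult_neq_0; [|exact Hb].
      unfold bfactor. apply Cmult_neq_0; [now apply Cminus_neq_0|].
      intros E. apply (Cminus_neq_0 _ _ Hza).
      replace (z - a)%C with ((z - a) * (1 - Cconj a * z) * / (1 - Cconj a * z))%C
        by (field; now apply bfactor_den_neq). rewrite E. ring.
    + intros [<-|Hin].
      * unfold bfactor. replace (a - a)%C with (RtoC 0) by ring. unfold Cdiv. ring.
      * rewrite (proj2 IH Hin). ring.
Qed.

(** Numerator and denominator of [blaschke], kept apart: only the numerator has zeros to divide out,
    while the denominator is a harmless holomorphic factor. *)
Definition zprod (zs : list C) (z : C) : C := fold_right (fun a acc => ((z - a) * acc)%C) 1%C zs.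
Definition dprod (zs : list C) (z : C) : C :=
  fold_right (fun a acc => ((1 - Cconj a * z) * acc)%C) 1%C zs.

Lemma zprod_neq_0 (zs : list C) (z : C) : ~ In z zs -> zprod zs z <> 0%C.
Proof.
  induction zs as [|a zs IH]; intros Hz.
  - simpl. intros E. injection E. lra.
  - simpl. apply Cmult_neq_0.
    + apply Cminus_neq_0. intros ->. apply Hz. now left.
    + apply IH. intros Hin. apply Hz. now right.
Qed.

Lemma dprod_neq_0 (zs : list C) (z : C) :
  List.Forall (fun a => Cmod a < 1) zs -> Cmod z <= 1 -> dprod zs z <> 0%C.
Proof.
  intros H Hz. induction H as [|a zs Ha _ IH]; simpl.
  - intros E. injection E. lra.
  - apply Cmult_neq_0; [now apply bfactor_den_neq|exact IH].
Qed.

Lemma dprod_cdiff (zs : list C) (z : C) : cdiff (dprod zs) z.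
Proof.
  induction zs as [|a zs IH]; [apply cdiff_const|].
  apply (cdiff_mult (fun z => 1 - Cconj a * z)%C); [|exact IH].
  apply cdiff_minus; [apply cdiff_const|]. apply cdiff_mult; [apply cdiff_const|apply cdiff_id].
Qed.

Lemma blaschke_zprod (zs : list C) (z : C) :
  List.Forall (fun a => Cmod a < 1) zs -> Cmod z <= 1 ->
  (blaschke zs z * dprod zs z)%C = zprod zs z.
Proof.
  intros H Hz. induction H as [|a zs Ha _ IH]; [simpl; ring|].
  rewrite blaschke_cons. simpl. rewrite <- IH. unfold bfactor. field.
  now apply bfactor_den_neq.
Qed.

(* Dividing by one more factor [zeta - a] is a partial fraction step:
   [1 / ((zeta - a) (zeta - z)) = (1 / (zeta - z) - 1 / (zeta - a)) / (z - a)]. *)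
Lemma cauchy_divided (F : C -> C) (r : R) (zs : list C) :
  (forall w, Cmod w < 1 -> cdiff F w) -> r < 1 ->
  NoDup zs -> (forall a, In a zs -> Cmod a < r /\ F a = 0%C) ->
  forall z, Cmod z < r -> ~ In z zs ->
  exists A, is_CI (fun t => F (polar r t) / zprod zs (polar r t) *
                            (polar r t / (polar r t - z)))%C 0 (2 * PI) A /\
    (zprod zs z * A)%C = (RtoC (2 * PI) * F z)%C.
Proof.
  intros HF Hr. induction zs as [|a zs IH]; intros Hnd Hzs z Hz Hnin.
  - exists (RtoC (2 * PI) * F z)%C. split; [|simpl; ring].
    apply is_CI_ext with (3 := cauchy_formula F r z HF Hz Hr); [pose proof two_PI_pos; lra|].
    intros t _. simpl. field. now apply polar_neq.
  - inversion_clear Hnd as [|x l Ha Hnd'].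
    assert (Hzs' : forall b, In b zs -> Cmod b < r /\ F b = 0%C).
    { intros b Hb. apply Hzs. now right. }
    destruct (Hzs a (or_introl eq_refl)) as [Har Fa].
    destruct (IH Hnd' Hzs' z Hz) as [A1 [I1 E1]].
    { intros Hin. apply Hnin. now right. }
    destruct (IH Hnd' Hzs' a Har Ha) as [A2 [I2 E2]].
    assert (Hza : (z - a)%C <> 0%C).
    { apply Cminus_neq_0. intros ->. apply Hnin. now left. }
    assert (HA2 : A2 = 0%C).
    { rewrite Fa in E2. pose proof (zprod_neq_0 zs a Ha) as Hne.
      replace A2 with (/ zprod zs a * (zprod zs a * A2))%C by (field; exact Hne).
      rewrite E2. ring. }
    exists (/ (z - a) * (A1 - A2))%C. split.
    + pose proof (is_CI_scal _ _ _ (/ (z - a))%C _ (is_CI_minus _ _ _ _ _ _ I1 I2)) as I.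
      apply is_CI_ext with (3 := I); [pose proof two_PI_pos; lra|].
      intros t _. simpl.
      pose proof (polar_neq r t z Hz) as N1. pose proof (polar_neq r t a Har) as N2.
      assert (N3 : zprod zs (polar r t) <> 0%C).
      { apply zprod_neq_0. intros Hin. apply (polar_neq r t _ (proj1 (Hzs' _ Hin))). ring. }
      field. now repeat split.
    + rewrite HA2. simpl. rewrite <- E1. field. exact Hza.
Qed.

(** Cauchy's formula for [F * dprod zs] divided by [zprod zs]: on the circle this quotient is
    [F / blaschke zs]. The mean of [|F|] on one circle suffices, with no maximum principle, and the
    empty list gives a plain growth bound. *)
Lemma schwarz_blaschke (F : C -> C) (r beta I : R) (zs : list C) (z : C) :
  (forall w, Cmod w < 1 -> cdiff F w) -> r < 1 -> NoDup zs ->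
  (forall a, In a zs -> Cmod a < r /\ F a = 0%C) -> Cmod z < r -> 0 < beta ->
  (forall w, Cmod w = r -> beta <= Cmod (blaschke zs w)) ->
  is_RInt (fun t => Cmod (F (polar r t))) 0 (2 * PI) I ->
  Cmod (F z) <= Cmod (blaschke zs z) * (r / (r - Cmod z) / beta * (I / (2 * PI))).
Proof.
  intros HF Hr Hnd Hzs Hz Hbeta HB HI.
  pose proof two_PI_pos as HP. pose proof (Cmod_ge_0 z) as Hz0.
  assert (Hin1 : List.Forall (fun a => Cmod a < 1) zs).
  { apply List.Forall_forall. intros a Ha. destruct (Hzs a Ha). lra. }
  set (k := r / (r - Cmod z) / beta).
  assert (Hk : 0 < k) by (repeat apply Rdiv_lt_0_compat; lra).
  (* The divided formula excludes the zeros themselves; there the left side is 0. *)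
  destruct (classic (In z zs)) as [Hin|Hin].
  { rewrite (proj2 (Hzs z Hin)), Cmod_0. apply Rmult_le_pos; [apply Cmod_ge_0|].
    apply Rmult_le_pos; [lra|]. apply Rdiv_le_0_compat; [|exact HP].
    rewrite <- (Rmult_0_r (2 * PI - 0)).
    assert (H0 : is_RInt (fun _ : R => 0) 0 (2 * PI) ((2 * PI - 0) * 0)) by apply (is_RInt_const (V := R_NormedModule)).
    refine (is_RInt_le _ _ _ _ _ _ _ H0 HI _); [lra|]. intros; apply Cmod_ge_0. }
  destruct (cauchy_divided (fun w => F w * dprod zs w)%C r zs) with (z := z) as [A [IA EA]];
    try assumption.
  { intros w Hw. apply cdiff_mult; [now apply HF|apply dprod_cdiff]. }
  { intros a Ha. destruct (Hzs a Ha) as [H1 H2]. split; [exact H1|]. rewrite H2. ring. }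
  assert (HA : Cmod A <= k * I).
  { refine (is_CI_le _ _ _ _ _ _ _ _ IA (is_RInt_scal _ _ _ k _ HI)); [lra|].
    intros t _. change (scal k (Cmod (F (polar r t)))) with (k * Cmod (F (polar r t))).
    assert (Hp : Cmod (polar r t) = r) by (rewrite Cmod_polar, Rabs_right; lra).
    specialize (HB (polar r t) Hp).
    assert (Hd : dprod zs (polar r t) <> 0%C) by (apply dprod_neq_0; [exact Hin1|lra]).
    assert (Hb : blaschke zs (polar r t) <> 0%C) by (apply Cmod_gt_0; lra).
    rewrite <- (blaschke_zprod zs (polar r t) Hin1 ltac:(lra)).
    replace (F (polar r t) * dprod zs (polar r t) /
             (blaschke zs (polar r t) * dprod zs (polar r t)))%C
      with (F (polar r t) / blaschke zs (polar r t))%C by (field; now split).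
    rewrite Cmod_mult, Cmod_div by exact Hb. unfold k.
    replace (r / (r - Cmod z) / beta * Cmod (F (polar r t)))
      with (Cmod (F (polar r t)) / beta * (r / (r - Cmod z))) by (field; lra).
    apply Rmult_le_compat; [|apply Cmod_ge_0| |now apply Cmod_kernel_le].
    - apply Rdiv_le_0_compat; [apply Cmod_ge_0|lra].
    - apply Rmult_le_compat_l; [apply Cmod_ge_0|]. apply Rinv_le_contravar; lra. }
  assert (Hdz : dprod zs z <> 0%C) by (apply dprod_neq_0; [exact Hin1|lra]).
  assert (EF : (RtoC (2 * PI) * F z)%C = (blaschke zs z * A)%C).
  { rewrite <- (blaschke_zprod zs z Hin1 ltac:(lra)) in EA.
    replace (RtoC (2 * PI) * F z)%C with (RtoC (2 * PI) * (F z * dprod zs z) / dprod zs z)%C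
      by (field; exact Hdz).
    rewrite <- EA. field. exact Hdz. }
  apply (f_equal Cmod) in EF. rewrite !Cmod_mult, Cmod_R, Rabs_right in EF by lra.
  apply Rmult_le_reg_l with (2 * PI); [exact HP|]. rewrite EF.
  replace (2 * PI * (Cmod (blaschke zs z) * (k * (I / (2 * PI)))))
    with (Cmod (blaschke zs z) * (k * I)) by (field; pose proof PI_neq0; lra).
  apply Rmult_le_compat_l; [apply Cmod_ge_0|exact HA].
Qed.

(** The second difference of the Cauchy kernel [1 / (p - z)] is [2 h ^ 2] over the product of the
    three differences. On the circle of radius [(1 + Rr) / 2] each of these is at least
    [(1 - Rr) / 2], whence the 16. *)
Lemma second_difference (f : C -> C) (Rr : R) (z h : C) :
  (forall w, Cmod w < 1 -> cdiff f w) -> (forall w, Cmod w < 1 -> Cmod (f w) <= 1) -> Rr < 1 ->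
  Cmod z <= Rr -> Cmod (z - h)%C <= Rr -> Cmod (z - 2 * h)%C <= Rr ->
  Cmod (f z - 2 * f (z - h) + f (z - 2 * h))%C <= 16 / (1 - Rr) ^ 3 * Cmod h ^ 2.
Proof.
  intros Hf Hf1 HR H0 H1 H2. pose proof two_PI_pos as HP. pose proof (Cmod_ge_0 z) as Hz0.
  set (r := (1 + Rr) / 2). set (d := (1 - Rr) / 2).
  assert (Hd : 0 < d) by (unfold d; lra).
  assert (Hr : r < 1) by (unfold r; lra). assert (Hr0 : Rr < r) by (unfold r; lra).
  pose proof (cauchy_formula f r z Hf ltac:(lra) Hr) as I0.
  pose proof (cauchy_formula f r _ Hf (Rle_lt_trans _ _ _ H1 Hr0) Hr) as I1.
  pose proof (cauchy_formula f r _ Hf (Rle_lt_trans _ _ _ H2 Hr0) Hr) as I2.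
  pose proof (is_CI_plus _ _ _ _ _ _ (is_CI_minus _ _ _ _ _ _ I0 (is_CI_scal _ _ _ 2%C _ I1)) I2) as I.
  apply is_CI_bound with (M := 2 * Cmod h ^ 2 / d ^ 3) in I; [|lra|].
  - replace (RtoC (2 * PI) * f z - 2 * (RtoC (2 * PI) * f (z - h)%C) + RtoC (2 * PI) * f (z - 2 * h)%C)%C
      with (RtoC (2 * PI) * (f z - 2 * f (z - h)%C + f (z - 2 * h)%C))%C in I by ring.
    rewrite Cmod_mult, Cmod_R, Rabs_right, Rminus_0_r in I by lra.
    apply Rmult_le_reg_l with (2 * PI); [exact HP|]. eapply Rle_trans; [exact I|].
    apply Req_le. unfold d. field. lra.
  - intros t _.
    pose proof (polar_neq r t z ltac:(lra)) as N0.
    pose proof (polar_neq r t _ (Rle_lt_trans _ _ _ H1 Hr0)) as N1.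
    pose proof (polar_neq r t _ (Rle_lt_trans _ _ _ H2 Hr0)) as N2.
    set (p := polar r t) in *.
    assert (Hp : Cmod p = r) by (unfold p; rewrite Cmod_polar, Rabs_right; unfold r; lra).
    replace (f p * (p / (p - z)) - 2 * (f p * (p / (p - (z - h)))) + f p * (p / (p - (z - 2 * h))))%C
      with ((f p * p * (2 * (h * h))) / ((p - z) * (p - (z - h)) * (p - (z - 2 * h))))%C
      by (field; now repeat split).
    rewrite Cmod_div by (repeat apply Cmult_neq_0; assumption).
    rewrite !Cmod_mult, Hp, Cmod_R, (Rabs_right 2) by lra.
    assert (Hge : forall w, Cmod w <= Rr -> d <= Cmod (p - w)%C).
    { intros w Hw. pose proof (Cmod_triangle_inv p w). unfold r, d in *. lra. }
    pose proof (Hge _ H0) as G0. pose proof (Hge _ H1) as G1. pose proof (Hge _ H2) as G2.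
    apply Rmult_le_compat.
    + repeat apply Rmult_le_pos; try apply Cmod_ge_0; try lra.
    + left. apply Rinv_0_lt_compat. repeat apply Rmult_lt_0_compat; lra.
    + pose proof (Hf1 p ltac:(lra)) as Hfp. pose proof (Cmod_ge_0 (f p)).
      replace (2 * Cmod h ^ 2) with (1 * (2 * (Cmod h * Cmod h))) by ring.
      assert (0 <= Cmod h * Cmod h) by apply Rle_0_sqr.
      apply Rmult_le_compat_r; [lra|]. nra.
    + apply Rinv_le_contravar; [apply pow_lt; lra|].
      replace (d ^ 3) with (d * d * d) by ring.
      repeat apply Rmult_le_compat; try lra. nra.
Qed.

(* Near [a] the hypothesis says nothing, so there [f] is recovered by extrapolation from two
   points at distance about [t]; one of the steps [t], [4 t] keeps both points away from [a]. *)
Lemma remove_bfactor (f : C -> C) (Rr M t : R) (a z : C) :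
  (forall w, Cmod w < 1 -> cdiff f w) -> (forall w, Cmod w < 1 -> Cmod (f w) <= 1) -> Rr < 1 ->
  Cmod a < 1 -> (forall w, Cmod w <= Rr -> Cmod (bfactor a w * f w)%C <= M) ->
  Cmod z <= Rr -> 0 < t -> 8 * t <= Rr ->
  Cmod (f z) <= 12 * (M / t) + 256 / (1 - Rr) ^ 3 * t ^ 2.
Proof.
  intros Hf Hf1 HR Ha HM Hz Ht HtR. pose proof (Cmod_ge_0 z) as Hz0.
  (* The samples are taken from [z] towards the origin and possibly past it, so that steps up to
     [Rr] stay in the disc; for [z = 0] any direction serves. *)
  assert (Hu : exists u, Cmod u = 1 /\ z = (RtoC (Cmod z) * u)%C).
  { destruct (classic (z = 0%C)) as [->|Hne].
    - exists 1%C. rewrite Cmod_0, Cmod_1. split; [reflexivity|ring].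
    - assert (0 < Cmod z) by now apply Cmod_gt_0.
      assert (N : RtoC (Cmod z) <> 0%C) by (intros E; injection E; lra).
      exists (z / RtoC (Cmod z))%C. split; [|field; exact N].
      rewrite Cmod_div, Cmod_R, Rabs_right by (try exact N; lra). field. lra. }
  destruct Hu as [u [Hu Ezu]].
  set (pt := fun s : R => (z - RtoC s * u)%C).
  assert (Hpt : forall s, 0 <= s <= Rr -> Cmod (pt s) <= Rr).
  { intros s Hs. unfold pt. rewrite Ezu at 1.
    replace (RtoC (Cmod z) * u - RtoC s * u)%C with (RtoC (Cmod z - s) * u)%C
      by (rewrite RtoC_minus; ring).
    rewrite Cmod_mult, Hu, Cmod_R, Rmult_1_r. apply Rabs_le. lra. }
  assert (Hsep : forall s s' : R, Rabs (s - s') <= Cmod (pt s - a)%C + Cmod (pt s' - a)%C).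
  { intros s s'.
    pose proof (Cmod_sub_trans (pt s) a (pt s')) as T. rewrite (Cmod_sub_sym a) in T.
    replace (Cmod (pt s - pt s')%C) with (Rabs (s - s')) in T; [exact T|].
    unfold pt. replace (z - RtoC s * u - (z - RtoC s' * u))%C with (RtoC (s' - s) * u)%C
      by (rewrite RtoC_minus; ring).
    rewrite Cmod_mult, Hu, Cmod_R, Rmult_1_r. apply Rabs_minus_sym. }
  (* At distance [t / 2] from [a] the factor is at least [t / 4]. The extrapolation weights 2 and 1
     later turn this 4 into 12. *)
  assert (Hval : forall s, 0 <= s <= Rr -> t / 2 <= Cmod (pt s - a)%C -> Cmod (f (pt s)) <= 4 * (M / t)).
  { intros s Hs Hd. pose proof (HM _ (Hpt s Hs)) as H. rewrite Cmod_mult in H.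
    pose proof (bfactor_ge a (pt s) Ha ltac:(pose proof (Hpt s Hs); lra)) as H'.
    pose proof (Cmod_ge_0 (f (pt s))).
    assert (t / 4 * Cmod (f (pt s)) <= M) by nra.
    apply Rmult_le_reg_l with (t / 4); [lra|].
    replace (t / 4 * (4 * (M / t))) with M by (field; lra). assumption. }
  (* If a sample at [t] or [2 t] is within [t / 2] of [a], those at [4 t] and [8 t] are at least
     [2 t] away from it, hence far from [a]. The largest step explains [8 * t <= Rr]. *)
  assert (Hstep : exists s, 0 < s <= 4 * t /\ t / 2 <= Cmod (pt s - a)%C /\ t / 2 <= Cmod (pt (2 * s)%R - a)%C).
  { destruct (Rle_lt_dec (t / 2) (Cmod (pt t - a)%C)) as [H1|H1];
    [destruct (Rle_lt_dec (t / 2) (Cmod (pt (2 * t)%R - a)%C)) as [H2|H2]|].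
    - exists t. repeat split; lra.
    - pose proof (Hsep (4 * t) (2 * t)) as S1. pose proof (Hsep (2 * (4 * t)) (2 * t)) as S2.
      rewrite Rabs_right in S1, S2 by lra. exists (4 * t). repeat split; lra.
    - pose proof (Hsep (4 * t) t) as S1. pose proof (Hsep (2 * (4 * t)) t) as S2.
      rewrite Rabs_right in S1, S2 by lra. exists (4 * t). repeat split; lra. }
  destruct Hstep as [s [Hs [D1 D2]]].
  pose proof (Hval s ltac:(lra) D1) as V1. pose proof (Hval (2 * s) ltac:(lra) D2) as V2.
  assert (E2 : (z - 2 * (RtoC s * u))%C = pt (2 * s)) by (unfold pt; rewrite RtoC_mult; ring).
  pose proof (second_difference f Rr z (RtoC s * u)%C Hf Hf1 HR Hz) as SD.
  rewrite E2 in SD. fold (pt s) in SD. specialize (SD (Hpt s ltac:(lra)) (Hpt (2 * s) ltac:(lra))).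
  rewrite Cmod_mult, Hu, Cmod_R, Rmult_1_r, pow2_abs in SD.
  replace (f z) with ((f z - 2 * f (pt s) + f (pt (2 * s)%R)) + (2 * f (pt s) - f (pt (2 * s)%R)))%C by ring.
  eapply Rle_trans; [apply Cmod_triangle|].
  assert (Cmod (2 * f (pt s) - f (pt (2 * s)%R))%C <= 12 * (M / t)).
  { eapply Rle_trans; [apply Cmod_sub_le|]. rewrite Cmod_mult, Cmod_R, Rabs_right by lra. lra. }
  assert (16 / (1 - Rr) ^ 3 * s ^ 2 <= 256 / (1 - Rr) ^ 3 * t ^ 2).
  { replace (256 / (1 - Rr) ^ 3 * t ^ 2) with (16 / (1 - Rr) ^ 3 * (16 * t ^ 2)) by (field; lra).
    apply Rmult_le_compat_l; [|nra]. left. apply Rdiv_lt_0_compat; [|apply pow_lt]; lra. }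
  lra.
Qed.

(** * Near-Fekete points *)

(** Compactness of the square [[-1, 1] ^ 2]: a point inside the disc has a neighbourhood away from
    the unit circle, any other point is outside the closure and has a neighbourhood free of [E]. *)
Lemma closure_in_disc_radius (E : C -> Prop) :
  (forall z, E z -> in_U z) -> (forall z, closure_C E z -> in_U z) ->
  exists s, 0 < s < 1 /\ forall z, E z -> Cmod z <= s.
Proof.
  intros HE Hcl.
  assert (Hd : forall u v, exists d : posreal, forall w, E w ->
    Rabs (fst w - u) < d -> Rabs (snd w - v) < d -> Cmod w <= 1 - d).
  { intros u v. set (p := (u, v) : C).
    assert (Hnear : forall w d, Rabs (fst w - u) < d -> Rabs (snd w - v) < d ->
      Cmod (w - p)%C < 2 * d).
    { intros w d H1 H2. eapply Rle_lt_trans; [apply Cmod_2Rmax|].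
      change (fst (w - p)%C) with (fst w - u). change (snd (w - p)%C) with (snd w - v).
      assert (Hm : Rmax (Rabs (fst w - u)) (Rabs (snd w - v)) < d) by now apply Rmax_lub_lt.
      assert (Hs : sqrt 2 <= 2).
      { rewrite <- (sqrt_pow2 2) at 2 by lra. apply sqrt_le_1_alt. lra. }
      pose proof (sqrt_pos 2). pose proof (Rmax_l (Rabs (fst w - u)) (Rabs (snd w - v))).
      pose proof (Rabs_pos (fst w - u)). nra. }
    destruct (Rlt_le_dec (Cmod p) 1) as [Hp|Hp].
    - assert (H0 : 0 < (1 - Cmod p) / 4) by lra. exists (mkposreal _ H0). simpl.
      intros w _ H1 H2. pose proof (Hnear w _ H1 H2) as H3.
      pose proof (Cmod_triangle_inv w p). lra.
    - assert (Hn : ~ closure_C E p) by (intros H; apply Hcl in H; unfold in_U in H; lra).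
      apply not_all_ex_not in Hn. destruct Hn as [d Hn].
      apply imply_to_and in Hn. destruct Hn as [Hd0 Hn].
      assert (H0 : 0 < d / 2) by lra. exists (mkposreal _ H0). simpl.
      intros w Hw H1 H2. exfalso. apply Hn. exists w. split; [exact Hw|].
      pose proof (Hnear w _ H1 H2). lra. }
  set (delta := fun u v => proj1_sig (constructive_indefinite_description _ (Hd u v))).
  assert (Hdelta : forall u v w, E w -> Rabs (fst w - u) < delta u v ->
    Rabs (snd w - v) < delta u v -> Cmod w <= 1 - delta u v).
  { intros u v. unfold delta. now destruct constructive_indefinite_description. }
  destruct (compactness_value_2d (-1) 1 (-1) 1 delta) as [d H].
  pose proof (cond_pos d) as Hd0.
  exists (Rmax (1 - d) (1 / 2)). split.
  { split; [apply Rlt_le_trans with (1 / 2); [lra|apply Rmax_r]|apply Rmax_lub_lt; lra]. }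
  intros w Hw. apply Rle_trans with (1 - d); [|apply Rmax_l].
  apply Rnot_lt_le; intros Hc.
  pose proof (HE w Hw) as Hw1. unfold in_U in Hw1.
  pose proof (Rmax_Cmod w) as Hm.
  pose proof (Rmax_l (Rabs (fst w)) (Rabs (snd w))). pose proof (Rmax_r (Rabs (fst w)) (Rabs (snd w))).
  apply (H (fst w) (snd w)).
  - apply Rabs_le_between. lra.
  - apply Rabs_le_between. lra.
  - intros [u [v (_ & _ & G1 & G2 & G3)]]. pose proof (Hdelta u v w Hw G1 G2). lra.
Qed.

(* The product of the pseudo-hyperbolic distances of all pairs of points of the list. *)
Fixpoint vdm (l : list C) : R :=
  match l with nil => 1 | a :: l' => Cmod (blaschke l' a) * vdm l' end.

Lemma vdm_pos (l : list C) : 0 <= vdm l.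
Proof.
  induction l as [|a l IH]; simpl; [lra|]. apply Rmult_le_pos; [apply Cmod_ge_0|exact IH].
Qed.

Lemma vdm_le_1 (l : list C) : List.Forall (fun a => Cmod a < 1) l -> vdm l <= 1.
Proof.
  induction 1 as [|a l Ha Hl IH]; simpl; [lra|].
  pose proof (blaschke_le_1 l a Hl ltac:(lra)). pose proof (Cmod_ge_0 (blaschke l a)).
  pose proof (vdm_pos l). nra.
Qed.

(** Rests on the symmetry of the pseudo-hyperbolic distance; it allows any point of a list to be
    moved to the head and split off. *)
Lemma vdm_perm (l l' : list C) :
  Permutation l l' -> List.Forall (fun a => Cmod a < 1) l -> vdm l = vdm l'.
Proof.
  induction 1 as [|x l l' Hp IH|x y l|l l' l'' Hp IH1 _ IH2]; intros Hl.
  - reflexivity.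
  - inversion_clear Hl. simpl. rewrite IH by assumption. now rewrite (blaschke_perm l l' x Hp).
  - inversion_clear Hl as [|? ? Hy Hl']. inversion_clear Hl' as [|? ? Hx _]. cbn [vdm].
    rewrite !blaschke_cons, !Cmod_mult, (bfactor_sym x y) by assumption. ring.
  - rewrite IH1 by exact Hl. apply IH2. now apply (Permutation_Forall Hp).
Qed.

Lemma vdm_NoDup (l : list C) : List.Forall (fun a => Cmod a < 1) l -> 0 < vdm l -> NoDup l.
Proof.
  induction 1 as [|a l Ha Hl IH]; simpl; intros Hv; [constructor|].
  pose proof (vdm_pos l) as Hp. pose proof (Cmod_ge_0 (blaschke l a)) as Hb.
  constructor.
  - intros Hin. rewrite (proj2 (blaschke_eq_0 l a Hl ltac:(lra)) Hin), Cmod_0 in Hv. lra.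
  - apply IH. nra.
Qed.

Lemma infinite_set_fresh (E : C -> Prop) (l : list C) :
  infinite_set E -> exists w, E w /\ ~ In w l.
Proof.
  intros HE. apply NNPP; intros H. apply HE. exists l. intros z Hz.
  apply NNPP; intros Hn. apply H. now exists z.
Qed.

Lemma infinite_set_blaschke_pos (E : C -> Prop) (l : list C) :
  (forall z, E z -> in_U z) -> infinite_set E -> (forall a, In a l -> E a) ->
  exists w, E w /\ 0 < Cmod (blaschke l w).
Proof.
  intros HU HE Hl. destruct (infinite_set_fresh E l HE) as [w [Hw Hn]].
  exists w. split; [exact Hw|]. apply Cmod_gt_0. intros E0. apply Hn.
  apply blaschke_eq_0 in E0; [exact E0| |left; apply HU, Hw].
  apply List.Forall_forall. intros a Ha. apply HU, Hl, Ha.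
Qed.

(** The supremum is finite, as all products are at most 1, and positive, as [E] is infinite; so some
    list exceeds half of it. *)
Lemma fekete_exists (E : C -> Prop) (n : nat) :
  (forall z, E z -> in_U z) -> infinite_set E ->
  exists l, length l = n /\ (forall a, In a l -> E a) /\ 0 < vdm l /\
    forall l', length l' = n -> (forall a, In a l' -> E a) -> vdm l' <= 2 * vdm l.
Proof.
  intros HU HE.
  set (S := fun x => exists l, length l = n /\ (forall a, In a l -> E a) /\ x = vdm l).
  assert (Hpos : exists l, length l = n /\ (forall a, In a l -> E a) /\ 0 < vdm l).
  { clear S. induction n as [|n [l (Hl & HlE & Hv)]].
    - exists nil. simpl. repeat split; [intros a []|lra].
    - destruct (infinite_set_blaschke_pos E l HU HE HlE) as [w [Hw Hb]].
      exists (w :: l). simpl. split; [now rewrite Hl|]. split.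
      + intros a [<-|Ha]; [exact Hw|now apply HlE].
      + now apply Rmult_lt_0_compat. }
  destruct Hpos as [l0 (Hl0 & Hl0E & Hv0)].
  destruct (completeness S) as [D [HD1 HD2]].
  - exists 1. intros x [l (_ & HlE & ->)]. apply vdm_le_1.
    apply List.Forall_forall. intros a Ha. apply HU, HlE, Ha.
  - exists (vdm l0), l0. now repeat split.
  - assert (HD : 0 < D).
    { apply Rlt_le_trans with (vdm l0); [exact Hv0|]. apply HD1. exists l0. now repeat split. }
    assert (Hx : exists l, length l = n /\ (forall a, In a l -> E a) /\ D / 2 < vdm l).
    { apply NNPP; intros Hn. assert (D <= D / 2); [|lra]. apply HD2.
      intros x [l (Hl & HlE & ->)]. apply Rnot_lt_le; intros Hc. apply Hn. now exists l. }
    destruct Hx as [l (Hl & HlE & Hv)]. exists l. repeat split; try assumption; [lra|].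
    intros l' Hl' HlE'. assert (vdm l' <= D); [|lra]. apply HD1. now exists l'.
Qed.

Lemma least_nat (P : nat -> Prop) : (exists n, P n) -> exists n, P n /\ forall m, (m < n)%nat -> ~ P m.
Proof.
  intros [n Hn]. induction n as [n IH] using (well_founded_induction Wf_nat.lt_wf).
  destruct (classic (exists m, (m < n)%nat /\ P m)) as [[m [Hm HP]]|H].
  - now apply (IH m).
  - exists n. split; [exact Hn|]. intros m Hm HP. apply H. now exists m.
Qed.

Lemma bfactor_bound_lt_1 (s Rr : R) : 0 < s < 1 -> 0 < Rr < 1 ->
  0 <= sqrt (1 - (1 - s ^ 2) * (1 - Rr ^ 2) / 4) < 1.
Proof.
  intros Hs HR. split; [apply sqrt_pos|].
  apply Rlt_le_trans with (sqrt 1); [|rewrite sqrt_1; lra]. apply sqrt_lt_1_alt.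
  assert (0 < 1 - s ^ 2 <= 1) by (split; nra). assert (0 < 1 - Rr ^ 2 <= 1) by (split; nra).
  assert (0 < (1 - s ^ 2) * (1 - Rr ^ 2) <= 1) by (split; nra). lra.
Qed.

(* For near-Fekete points [l] with [n + 1] points and [l0] with [n], a point [w] of [E] with
   [|B_l0 w| > eps] forces [|B_(l - a) a| >= eps / 4] for every [a] in [l]. *)
Lemma blaschke_selection (E : C -> Prop) (s : R) (N : nat) :
  (forall z, E z -> Cmod z <= s) -> 0 < s < 1 -> infinite_set E ->
  exists eps0, 0 < eps0 /\ forall eps, 0 < eps < eps0 ->
  exists l, (N <= length l)%nat /\ NoDup l /\ (forall a, In a l -> E a) /\
    (forall z, E z -> Cmod (blaschke l z) <= eps) /\
    (forall a l', Permutation l (a :: l') -> eps / 4 <= Cmod (blaschke l' a)).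
Proof.
  intros Hs Hs1 HE.
  assert (HU : forall z, E z -> in_U z) by (intros z Hz; specialize (Hs z Hz); unfold in_U; lra).
  assert (HF : forall l, (forall a, In a l -> E a) -> List.Forall (fun a => Cmod a < 1) l).
  { intros l Hl. apply List.Forall_forall. intros a Ha. apply HU, Hl, Ha. }
  set (F := fun n => proj1_sig (constructive_indefinite_description _ (fekete_exists E n HU HE))).
  assert (HFn : forall n, length (F n) = n /\ (forall a, In a (F n) -> E a) /\ 0 < vdm (F n) /\
    forall l', length l' = n -> (forall a, In a l' -> E a) -> vdm l' <= 2 * vdm (F n)).
  { intros n. unfold F. now destruct constructive_indefinite_description. }
  (* No product with fewer than [N] zeros vanishes on all of [E]. A threshold below these finitely
     many values forces the least admissible [n] to be at least [N]. *)
  assert (Heps0 : exists eps0, 0 < eps0 /\ forall n, (n < N)%nat ->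
    exists w, E w /\ eps0 <= Cmod (blaschke (F n) w)).
  { induction N as [|N [e [He IH]]]; [exists 1; split; [lra|intros; lia]|].
    destruct (infinite_set_blaschke_pos E (F N) HU HE) as [w [Hw Hb]]; [apply HFn|].
    exists (Rmin e (Cmod (blaschke (F N) w))). split; [now apply Rmin_pos|].
    intros n Hn. destruct (Nat.eq_dec n N) as [->|Hne].
    - exists w. split; [exact Hw|apply Rmin_r].
    - destruct (IH n ltac:(lia)) as [v [Hv Hbv]]. exists v. split; [exact Hv|].
      eapply Rle_trans; [apply Rmin_l|exact Hbv]. }
  destruct Heps0 as [e0 [He0 Hlow]].
  exists (Rmin e0 1). split; [apply Rmin_pos; lra|]. intros eps [Heps Heps1].
  assert (Hel : eps < e0) by (eapply Rlt_le_trans; [exact Heps1|apply Rmin_l]).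
  assert (Hel1 : eps < 1) by (eapply Rlt_le_trans; [exact Heps1|apply Rmin_r]).
  destruct (least_nat (fun n => forall z, E z -> Cmod (blaschke (F n) z) <= eps)) as [n [Hn Hmin]].
  (* Some [n] is admissible, because on [E] every factor is at most [q < 1], so the product is at
     most [q ^ n]. *)
  { set (q := sqrt (1 - (1 - s ^ 2) * (1 - s ^ 2) / 4)).
    assert (Hq : 0 <= q < 1).
{ apply bfactor_bound_lt_1; lra. }
    destruct (pow_lt_1_zero q ltac:(rewrite Rabs_right; lra) eps Heps) as [n Hn].
    exists n. intros z Hz. specialize (Hn n (Nat.le_refl n)).
    rewrite Rabs_right in Hn by (apply Rle_ge, pow_le; lra).
    destruct (HFn n) as (Hlen & HlE & _).
    eapply Rle_trans; [apply (blaschke_le_pow _ _ q)|rewrite Hlen; lra].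
    intros a Ha. apply bfactor_le; try lra; apply Hs; [now apply HlE|exact Hz]. }
  exists (F n). destruct (HFn n) as (Hlen & HlE & Hv & Hmax).
  split; [|split; [|split; [exact HlE|split; [exact Hn|]]]].
  - rewrite Hlen. apply Nat.nlt_ge. intros Hc. destruct (Hlow n Hc) as [w [Hw Hb]].
    specialize (Hn w Hw). lra.
  - apply vdm_NoDup; [now apply HF|exact Hv].
  - intros a l' Hp.
    assert (Hlen' : n = S (length l')) by (rewrite <- Hlen, (Permutation_length Hp); reflexivity).
    specialize (Hmin (length l') ltac:(lia)).
    apply not_all_ex_not in Hmin. destruct Hmin as [w Hw].
    apply imply_to_and in Hw. destruct Hw as [HwE Hw]. apply Rnot_le_lt in Hw.
    destruct (HFn (length l')) as (Hlen0 & HlE0 & Hv0 & Hmax0).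
    assert (HlE' : forall b, In b l' -> E b).
    { intros b Hb. apply HlE. apply (Permutation_in b (Permutation_sym Hp)). now right. }
    rewrite (vdm_perm _ _ Hp (HF _ HlE)) in Hv, Hmax. cbn [vdm] in Hv, Hmax.
    specialize (Hmax0 l' eq_refl HlE').
    specialize (Hmax (w :: F (length l'))). cbn [vdm length] in Hmax.
    specialize (Hmax ltac:(rewrite Hlen0; now symmetry)).
    (* Near-maximality is used twice: here for [w] added to the smaller near-Fekete list, and in
       [Hmax0] for [l'] against that list. Each use costs a factor 2. *)
    assert (Hmax' : Cmod (blaschke (F (length l')) w) * vdm (F (length l')) <=
      2 * (Cmod (blaschke l' a) * vdm l')).
    { apply Hmax. intros b [<-|Hb]; [exact HwE|now apply HlE0]. }
    pose proof (vdm_pos l') as Hv'. pose proof (Cmod_ge_0 (blaschke l' a)) as Hb.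
    assert (Hv'' : 0 < vdm l') by nra.
    apply Rmult_le_reg_r with (vdm l'); [exact Hv''|].
    assert (eps * vdm (F (length l')) <= Cmod (blaschke (F (length l')) w) * vdm (F (length l')))
      by (apply Rmult_le_compat_r; lra).
    nra.
Qed.

(** * The unit ball of the Hardy space *)

Lemma rpow_pos_eq (x y : R) : 0 < x -> rpow x y = Rpower x y.
Proof. intros H. unfold rpow. now destruct (Rlt_dec 0 x). Qed.

Lemma rpow_nonpos (x y : R) : x <= 0 -> rpow x y = 0.
Proof. intros H. unfold rpow. destruct (Rlt_dec 0 x); [lra|reflexivity]. Qed.

Lemma rpow_ge_0 (x y : R) : 0 <= rpow x y.
Proof. unfold rpow. destruct (Rlt_dec 0 x); [left; apply exp_pos|lra]. Qed.

Lemma rpow_le (x x' y : R) : 0 <= y -> x <= x' -> rpow x y <= rpow x' y.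
Proof.
  intros Hy Hx. destruct (Rlt_le_dec 0 x) as [H|H].
  - rewrite !rpow_pos_eq by lra. apply Rle_Rpower_l; lra.
  - rewrite (rpow_nonpos x) by exact H. apply rpow_ge_0.
Qed.

Lemma rpow_1_l (y : R) : rpow 1 y = 1.
Proof. rewrite rpow_pos_eq by lra. unfold Rpower. rewrite ln_1, Rmult_0_r. apply exp_0. Qed.

Lemma rpow_inv (x q : R) : 0 < x -> 0 < q -> rpow (rpow x q) (/ q) = x.
Proof.
  intros Hx Hq. rewrite (rpow_pos_eq x) by exact Hx. rewrite rpow_pos_eq by apply exp_pos.
  rewrite Rpower_mult, Rinv_r by lra. now apply Rpower_1.
Qed.

Lemma rpow_inv' (x q : R) : 0 < x -> 0 < q -> rpow (rpow x (/ q)) q = x.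
Proof.
  intros Hx Hq. rewrite <- (Rinv_inv q) at 2. apply rpow_inv; [exact Hx|].
  now apply Rinv_0_lt_compat.
Qed.

(** A substitute for Hölder's inequality: it passes from means of order [q] to means of order 1 at
    the price of an additive 1. *)
Lemma le_1_add_rpow (x q : R) : 0 <= x -> 1 <= q -> x <= 1 + rpow x q.
Proof.
  intros Hx Hq. destruct (Rle_lt_dec x 1) as [H|H].
  - pose proof (rpow_ge_0 x q). lra.
  - rewrite rpow_pos_eq by lra. rewrite <- (Rpower_1 x) at 1 by lra.
    assert (Rpower x 1 <= Rpower x q) by (apply Rle_Rpower; lra). lra.
Qed.

Lemma rpow_continuous (q x : R) : 1 <= q -> continuous (fun y => rpow y q) x.
Proof.
  intros Hq. destruct (total_order_T 0 x) as [[Hx| <-]|Hx].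
  - apply continuous_ext_loc with (fun y => Rpower y q).
    + exists (mkposreal x Hx). intros y Hy. change (Rabs (y - x) < x) in Hy.
      apply Rabs_def2 in Hy. symmetry. apply rpow_pos_eq. lra.
    + unfold Rpower. apply (continuous_comp (fun y => q * ln y) exp).
      * apply (continuous_scal_r (K := R_AbsRing) (V := R_NormedModule) q ln).
        apply continuity_pt_filterlim. apply derivable_continuous_pt.
        exists (/ x). now apply derivable_pt_lim_ln.
      * apply continuity_pt_filterlim. apply derivable_continuous_pt, derivable_pt_exp.
  - intros P [e He]. exists (mkposreal (Rmin e 1) (Rmin_pos _ _ (cond_pos e) Rlt_0_1)).
    intros y Hy. change (Rabs (y - 0) < Rmin e 1) in Hy. apply He.
    change (Rabs (rpow y q - rpow 0 q) < e).
    rewrite (rpow_nonpos 0), Rminus_0_r in * by lra.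
    pose proof (Rmin_l e 1). pose proof (Rmin_r e 1). pose proof (cond_pos e).
    destruct (Rlt_le_dec 0 y) as [Hy0|Hy0]; [|rewrite rpow_nonpos, Rabs_R0 by exact Hy0; lra].
    rewrite (Rabs_right y) in Hy by lra.
    rewrite Rabs_right by apply Rle_ge, rpow_ge_0. rewrite rpow_pos_eq by exact Hy0.
    apply Rle_lt_trans with y; [|lra].
    rewrite <- (Rpower_1 y) at 2 by exact Hy0. unfold Rpower.
    assert (ln y < 0) by (rewrite <- ln_1; apply ln_increasing; lra).
    destruct (Req_dec q 1) as [->|Hq1]; [lra|]. left. apply exp_increasing. nra.
  - apply continuous_ext_loc with (fun _ => 0); [|apply continuous_const].
    assert (Hx' : 0 < - x) by lra. exists (mkposreal _ Hx').
    intros y Hy. change (Rabs (y - x) < - x) in Hy. apply Rabs_def2 in Hy.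
    symmetry. apply rpow_nonpos. lra.
Qed.


Lemma ex_RInt_circle (f : C -> C) (r : R) (phi : R -> R) :
  (forall t, ccont f (polar r t)) -> (forall x, continuous phi x) ->
  ex_RInt (fun t => phi (Cmod (f (polar r t)))) 0 (2 * PI).
Proof.
  intros Hf Hphi. apply (ex_RInt_continuous (V := R_CompleteNormedModule)). intros t _.
  apply (continuous_comp (fun t => Cmod (f (polar r t))) phi); [|apply Hphi].
  apply (rcont_Cmod (fun t => f (polar r t))), rcont_comp; [apply Hf|apply rcont_polar].
Qed.

Lemma Mp_between (p : Rbar) (f : C -> C) (r m : R) :
  valid_exp p -> (forall t, ccont f (polar r t)) -> 0 < m ->
  (forall t, m <= Cmod (f (polar r t)) <= 1) -> m <= Mp p f r <= 1.
Proof.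
  intros Hp Hf Hm Hb. pose proof two_PI_pos as HP. destruct p as [q| |]; simpl in Hp; [| |contradiction].
  - assert (Hex : ex_RInt (fun t => rpow (Cmod (f (polar r t))) q) 0 (2 * PI)).
    { apply (ex_RInt_circle f r (fun x => rpow x q)); [exact Hf|]. intros x. now apply rpow_continuous. }
    pose proof (RInt_correct _ _ _ Hex) as HI. simpl Mp.
    set (I := RInt _ 0 (2 * PI)) in *.
    assert (H1 : (2 * PI - 0) * rpow m q <= I).
    { refine (is_RInt_le _ _ _ _ _ _ _ (is_RInt_const (V := R_NormedModule) 0 (2 * PI) (rpow m q)) HI _); [lra|].
      intros t _. apply rpow_le; [lra|apply Hb]. }
    assert (H2 : I <= (2 * PI - 0) * 1).
    { refine (is_RInt_le _ _ _ _ _ _ _ HI (is_RInt_const (V := R_NormedModule) 0 (2 * PI) 1) _); [lra|].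
      intros t _. rewrite <- (rpow_1_l q). apply rpow_le; [lra|apply Hb]. }
    rewrite Rminus_0_r in H1, H2.
    assert (Hinv : 0 < / (2 * PI)) by now apply Rinv_0_lt_compat.
    assert (Hq : 0 <= / q) by (left; apply Rinv_0_lt_compat; lra).
    assert (Em : rpow m q = / (2 * PI) * (2 * PI * rpow m q)) by (field; pose proof PI_neq0; lra).
    assert (E1 : 1 = / (2 * PI) * (2 * PI * 1)) by (field; pose proof PI_neq0; lra).
    split.
    + rewrite <- (rpow_inv m q) at 1 by lra. apply rpow_le; [exact Hq|]. rewrite Em.
      apply Rmult_le_compat_l; lra.
    + rewrite <- (rpow_1_l (/ q)). apply rpow_le; [exact Hq|]. rewrite E1.
      apply Rmult_le_compat_l; lra.
  - simpl. destruct (Lub_Rbar_correct (fun x => exists t, x = Cmod (f (polar r t)))) as [L1 L2].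
    specialize (L1 (Cmod (f (polar r 0)))).
    specialize (L2 (Finite 1)).
    assert (G1 : Rbar_le (Cmod (f (polar r 0))) (Lub_Rbar (fun x => exists t, x = Cmod (f (polar r t))))).
    { apply L1. now exists 0. }
    assert (G2 : Rbar_le (Lub_Rbar (fun x => exists t, x = Cmod (f (polar r t)))) 1).
    { apply L2. intros x [t ->]. apply Hb. }
    destruct (Lub_Rbar _) as [l| |]; simpl in *; try contradiction.
    specialize (Hb 0). lra.
Qed.

(** On [|z| = r] the modulus lies between [1 - c * (1 - r)] and 1, and so does every mean; the norm
    is therefore exactly 1. *)
Lemma blaschke_unit_ball (p : Rbar) (zs : list C) :
  valid_exp p -> List.Forall (fun a => Cmod a < 1) zs -> Hp_unit_ball p (blaschke zs).
Proof.
  intros Hp Hzs. split.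
  - intros z Hz. apply ex_derive_cdiff, blaschke_cdiff; [exact Hzs|]. now left.
  - exists 1. split; [|lra]. intros P [e He].
    destruct (blaschke_near_circle zs Hzs) as [c [Hc Hnear]].
    pose proof (cond_pos e) as He0.
    (* Makes [r] positive and [c * (1 - r)] smaller than both [e] and 1; the latter keeps the lower
       bound in [Mp_between] positive. *)
    set (d := Rmin 1 (Rmin 1 e / (c + 1))).
    assert (Hme : 0 < Rmin 1 e) by (apply Rmin_pos; lra).
    assert (Hd : 0 < d) by (apply Rmin_pos; [lra|]; apply Rdiv_lt_0_compat; lra).
    exists (mkposreal d Hd). intros r Hr Hr1. change (Rabs (r - 1) < d) in Hr.
    apply Rabs_def2 in Hr. apply He.
    pose proof (Rmin_l 1 (Rmin 1 e / (c + 1))) as D1. pose proof (Rmin_r 1 (Rmin 1 e / (c + 1))) as D2.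
    fold d in D1, D2.
    pose proof (Rmin_l 1 e) as E1. pose proof (Rmin_r 1 e) as E2.
    assert (Hcd : c * (1 - r) < Rmin 1 e).
    { apply Rle_lt_trans with (c * (Rmin 1 e / (c + 1))).
      - apply Rmult_le_compat_l; lra.
      - replace (c * (Rmin 1 e / (c + 1))) with (Rmin 1 e - Rmin 1 e / (c + 1)) by (field; lra).
        assert (0 < Rmin 1 e / (c + 1)) by (apply Rdiv_lt_0_compat; lra). lra. }
    assert (Hmod : forall t, Cmod (polar r t) = r) by (intros t; rewrite Cmod_polar, Rabs_right; lra).
    assert (HM : 1 - c * (1 - r) <= Mp p (blaschke zs) r <= 1).
    { apply Mp_between; [exact Hp| |lra|].
      - intros t. apply cdiff_ccont, blaschke_cdiff; [exact Hzs|]. rewrite Hmod. lra.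
      - intros t. specialize (Hnear (polar r t)). rewrite Hmod in Hnear. split; [lra|].
        apply blaschke_le_1; [exact Hzs|]. rewrite Hmod. lra. }
    change (Rabs (Mp p (blaschke zs) r - 1) < e). apply Rabs_def1; lra.
Qed.

Lemma is_RInt_circle_Cmod (f : C -> C) (r : R) :
  (forall w, Cmod w < 1 -> cdiff f w) -> 0 <= r < 1 ->
  exists I : R, is_RInt (fun t => Cmod (f (polar r t))) 0 (2 * PI) I.
Proof.
  intros Hf Hr. apply (ex_RInt_circle f r (fun x => x)).
  - intros t. apply cdiff_ccont, Hf. rewrite Cmod_polar, Rabs_right; lra.
  - intros x. apply continuous_id.
Qed.

Lemma bounded_on_disc (f : C -> C) (r : R) :
  (forall w, Cmod w < 1 -> cdiff f w) -> 0 <= r < 1 ->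
  exists M, forall z, Cmod z <= r -> Cmod (f z) <= M.
Proof.
  intros Hf Hr. set (r' := (1 + r) / 2). pose proof two_PI_pos as HP.
  assert (Hr' : r < r' < 1) by (unfold r'; lra).
  destruct (is_RInt_circle_Cmod f r' Hf ltac:(lra)) as [I HI].
  assert (HI0 : 0 <= I).
  { replace 0 with ((2 * PI - 0) * 0) by ring.
    refine (is_RInt_le _ _ _ _ _ _ _ (is_RInt_const (V := R_NormedModule) 0 (2 * PI) 0) HI _); [lra|].
    intros; apply Cmod_ge_0. }
  exists (r' / (r' - r) * (I / (2 * PI))). intros z Hz.
  eapply Rle_trans.
  { apply (schwarz_blaschke f r' 1 I nil z); try assumption; try lra.
    - constructor.
    - intros a [].
    - intros w _. simpl. rewrite Cmod_1. lra. }
  simpl. rewrite Cmod_1, Rmult_1_l, Rdiv_1_r.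
  apply Rmult_le_compat_r; [apply Rdiv_le_0_compat; assumption|].
  apply Rmult_le_compat_l; [lra|]. apply Rinv_le_contravar; lra.
Qed.

(** The norm is only a limit as [r] tends to 1, so the means are known to be below 2 just for [r]
    beyond some [r0] depending on [g]. The bound [K] depends on [p] alone, as the final constant
    requires. *)
Lemma unit_ball_mean_bound (p : Rbar) : valid_exp p ->
  exists K, 0 < K /\ forall g, Hp_unit_ball p g ->
  exists r0, 0 <= r0 < 1 /\ forall r, r0 < r < 1 ->
  exists I : R, is_RInt (fun t => Cmod (g (polar r t))) 0 (2 * PI) I /\ I <= 2 * PI * K.
Proof.
  intros Hp. pose proof two_PI_pos as HP.
  assert (Hev : forall g, Hp_unit_ball p g -> (forall w, Cmod w < 1 -> cdiff g w) /\
    exists r0, 0 <= r0 < 1 /\ forall r, r0 < r < 1 -> Mp p g r < 2).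
  { intros g [Hg [l [Hl Hl1]]]. split.
    { intros w Hw. apply ex_derive_cdiff, Hg, Hw. }
    assert (Hloc : locally l (fun x => x < 2)).
    { assert (H0 : 0 < 2 - l) by lra. exists (mkposreal _ H0). intros y Hy.
      change (Rabs (y - l) < 2 - l) in Hy. apply Rabs_def2 in Hy. lra. }
    destruct (Hl _ Hloc) as [d Hd].
    exists (Rmax 0 (1 - d)). pose proof (cond_pos d) as Hd0.
    split; [split; [apply Rmax_l|apply Rmax_lub_lt; lra]|].
    intros r [Hr Hr1]. apply Hd; [|exact Hr1].
    change (Rabs (r - 1) < d). pose proof (Rmax_r 0 (1 - d)). apply Rabs_def1; lra. }
  destruct p as [q| |]; simpl in Hp; [| |contradiction].
  - exists (1 + rpow 2 q). split; [pose proof (rpow_ge_0 2 q); lra|].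
    intros g Hg. destruct (Hev g Hg) as [Hd [r0 [Hr0 HM]]]. exists r0. split; [exact Hr0|].
    intros r Hr. destruct (is_RInt_circle_Cmod g r Hd ltac:(lra)) as [I HI].
    exists I. split; [exact HI|]. specialize (HM r Hr). simpl in HM.
    assert (Hex : ex_RInt (fun t => rpow (Cmod (g (polar r t))) q) 0 (2 * PI)).
    { apply (ex_RInt_circle g r (fun x => rpow x q)).
      - intros t. apply cdiff_ccont, Hd. rewrite Cmod_polar, Rabs_right; lra.
      - intros x. now apply rpow_continuous. }
    pose proof (RInt_correct _ _ _ Hex) as HJ.
    set (J := RInt _ 0 (2 * PI)) in *.
    assert (HJ2 : / (2 * PI) * J <= rpow 2 q).
    { destruct (Rle_lt_dec (/ (2 * PI) * J) 0) as [H0|H0]; [pose proof (rpow_ge_0 2 q); lra|].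
      rewrite <- (rpow_inv' (/ (2 * PI) * J) q) by lra. apply rpow_le; lra. }
    assert (HIJ : I <= (2 * PI - 0) * 1 + J).
    { refine (is_RInt_le _ _ _ _ _ _ _ HI (is_RInt_plus (V := R_NormedModule) _ _ _ _ _ _
        (is_RInt_const (V := R_NormedModule) 0 (2 * PI) 1) HJ) _); [lra|].
      intros t _. apply (le_1_add_rpow _ q); [apply Cmod_ge_0|exact Hp]. }
    apply Rmult_le_compat_l with (r := 2 * PI) in HJ2; [|lra].
    rewrite <- Rmult_assoc, Rinv_r, Rmult_1_l in HJ2 by lra. lra.
  - exists 2. split; [lra|].
    intros g Hg. destruct (Hev g Hg) as [Hd [r0 [Hr0 HM]]]. exists r0. split; [exact Hr0|].
    intros r Hr. destruct (is_RInt_circle_Cmod g r Hd ltac:(lra)) as [I HI].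
    exists I. split; [exact HI|]. specialize (HM r Hr). simpl in HM.
    (* [real] sends an infinite supremum to 0, so [Mp p_infty g r < 2] says something about [g] only
       once the supremum is known to be finite. *)
    destruct (bounded_on_disc g r Hd ltac:(lra)) as [M HMb].
    destruct (Lub_Rbar_correct (fun x => exists t, x = Cmod (g (polar r t)))) as [L1 L2].
    specialize (L2 (Finite M)).
    assert (G2 : Rbar_le (Lub_Rbar (fun x => exists t, x = Cmod (g (polar r t)))) M).
    { apply L2. intros x [t ->]. apply HMb. rewrite Cmod_polar, Rabs_right; lra. }
    assert (Hb : forall t, Cmod (g (polar r t)) <= 2).
    { intros t. specialize (L1 (Cmod (g (polar r t))) (ex_intro _ t eq_refl)).
      destruct (Lub_Rbar _) as [l| |]; simpl in *; try contradiction. lra. }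
    replace (2 * PI * 2) with ((2 * PI - 0) * 2) by ring.
    refine (is_RInt_le _ _ _ _ _ _ _ HI (is_RInt_const (V := R_NormedModule) 0 (2 * PI) 2) _); [lra|].
    intros t _. apply Hb.
Qed.

(** * The interpolation estimate *)

Lemma NoDup_split (l : list C) : NoDup l -> exists rem : C -> list C,
  forall a, In a l -> Permutation l (a :: rem a) /\ ~ In a (rem a).
Proof.
  intros Hl.
  assert (H : forall a, exists l', In a l -> Permutation l (a :: l') /\ ~ In a l').
  { intros a. destruct (classic (In a l)) as [Ha|Ha]; [|exists nil; contradiction].
    destruct (in_split a l Ha) as [l1 [l2 ->]]. exists (l1 ++ l2). intros _. split.
    - symmetry. apply Permutation_middle.
    - now apply NoDup_remove_2. }
  exists (fun a => proj1_sig (constructive_indefinite_description _ (H a))).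
  intros a. now destruct constructive_indefinite_description.
Qed.

(** Lagrange's formula with Blaschke products: [W] is the sum over [a] of [v a / B_a a] times [B_a],
    where [B_a] omits the zero [a]. The hypothesis bounds each coefficient by [c]. *)
Lemma blaschke_interpolation (l : list C) (v : C -> C) (c : R) :
  List.Forall (fun a => Cmod a < 1) l -> NoDup l -> 0 <= c ->
  (forall a l', Permutation l (a :: l') -> Cmod (v a) <= c * Cmod (blaschke l' a)) ->
  exists W, (forall z, Cmod z < 1 -> cdiff W z) /\ (forall a, In a l -> W a = v a) /\
    forall z m, (forall a l', Permutation l (a :: l') -> Cmod (blaschke l' z) <= m) ->
      Cmod (W z) <= c * INR (length l) * m.
Proof.
  intros Hl Hnd Hc Hv. destruct (NoDup_split l Hnd) as [rem Hrem].
  assert (Hlt : forall a, In a l -> Cmod a < 1) by now apply List.Forall_forall.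
  assert (Hrem1 : forall a, In a l -> List.Forall (fun b => Cmod b < 1) (rem a)).
  { intros a Ha. destruct (Hrem a Ha) as [Hp _].
    pose proof (Permutation_Forall Hp Hl) as H. now inversion_clear H. }
  assert (Hrem0 : forall a, In a l -> 0 < Cmod (blaschke (rem a) a)).
  { intros a Ha. apply Cmod_gt_0. intros E. apply (Hrem a Ha).
    apply (blaschke_eq_0 _ _ (Hrem1 a Ha)); [left; now apply Hlt|exact E]. }
  (* The induction runs over the nodes already treated, while every product keeps all other zeros of
     the full list [l]; hence a new summand disturbs no earlier value. *)
  assert (H : forall s, (forall a, In a s -> In a l) -> NoDup s ->
    exists W, (forall z, Cmod z < 1 -> cdiff W z) /\
      (forall a, In a s -> W a = v a) /\ (forall a, In a l -> ~ In a s -> W a = 0%C) /\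
      forall z m, (forall a l', Permutation l (a :: l') -> Cmod (blaschke l' z) <= m) ->
        Cmod (W z) <= c * INR (length s) * m).
  { induction s as [|a s IH]; intros Hs Hnds.
    - exists (fun _ => 0%C). repeat split.
      + intros; apply cdiff_const.
      + intros a [].
      + intros z m _. rewrite Cmod_0. simpl. lra.
    - inversion_clear Hnds as [|? ? Has Hnds'].
      assert (Hal : In a l) by (apply Hs; now left).
      destruct (IH (fun b Hb => Hs b (or_intror Hb)) Hnds') as [W (W1 & W2 & W3 & W4)].
      destruct (Hrem a Hal) as [Hpa _]. pose proof (Hrem0 a Hal) as H0.
      assert (N : blaschke (rem a) a <> 0%C) by now apply Cmod_gt_0.
      set (k := (v a / blaschke (rem a) a)%C).
      assert (Hk : Cmod k <= c).
      { unfold k. rewrite Cmod_div by exact N.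
        apply Rmult_le_reg_r with (Cmod (blaschke (rem a) a)); [exact H0|].
        unfold Rdiv. rewrite Rmult_assoc, Rinv_l, Rmult_1_r by lra. now apply Hv. }
      assert (Hother : forall b, In b l -> b <> a -> blaschke (rem a) b = 0%C).
      { intros b Hb Hba. apply (blaschke_eq_0 _ _ (Hrem1 a Hal)); [left; now apply Hlt|].
        apply (Permutation_in b Hpa) in Hb. destruct Hb as [->|Hb]; [contradiction|exact Hb]. }
      exists (fun z => k * blaschke (rem a) z + W z)%C. repeat split.
      + intros z Hz. apply cdiff_plus; [|now apply W1]. apply cdiff_mult; [apply cdiff_const|].
        apply blaschke_cdiff; [now apply Hrem1|now left].
      + intros b [<-|Hb].
        * rewrite W3 by assumption. unfold k. field. exact N.
        * rewrite W2 by exact Hb. rewrite Hother; [ring| |].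
          -- apply Hs. now right.
          -- intros ->. contradiction.
      + intros b Hb Hbs. rewrite W3 by (try exact Hb; intros Hin; apply Hbs; now right).
        rewrite Hother; [ring|exact Hb|]. intros ->. apply Hbs. now left.
      + intros z m Hm. eapply Rle_trans; [apply Cmod_triangle|]. rewrite Cmod_mult.
        pose proof (W4 z m Hm) as HW. pose proof (Hm _ _ Hpa) as Hma.
        pose proof (Cmod_ge_0 (blaschke (rem a) z)). pose proof (Cmod_ge_0 k).
        assert (Cmod k * Cmod (blaschke (rem a) z) <= c * m) by (apply Rmult_le_compat; lra).
        cbn [length]. rewrite S_INR. lra. }
  destruct (H l (fun a Ha => Ha) Hnd) as [W (W1 & W2 & _ & W4)]. now exists W.
Qed.

(** Split [g] into its interpolant [W], with coefficients at most 4, and a remainder vanishing on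
    [l], to which the Schwarz lemma applies. The mean of the remainder is at most [K + 4 n], since
    every [|B_a|] is at most 1. *)
Lemma interpolation_estimate (g : C -> C) (l : list C) (K Rr r0 s m : R) (z : C) :
  (forall w, Cmod w < 1 -> cdiff g w) -> 0 < s < 1 -> (forall a, In a l -> Cmod a <= s) ->
  NoDup l -> (forall a l', Permutation l (a :: l') -> Cmod (g a) <= 4 * Cmod (blaschke l' a)) ->
  r0 < 1 ->
  (forall r, r0 < r < 1 ->
     exists I : R, is_RInt (fun t => Cmod (g (polar r t))) 0 (2 * PI) I /\ I <= 2 * PI * K) ->
  0 < Rr < 1 -> Cmod z <= Rr ->
  (forall a l', Permutation l (a :: l') -> Cmod (blaschke l' z) <= m) ->
  Cmod (g z) <= 4 * INR (length l) * m +
    Cmod (blaschke l z) * (4 / (1 - Rr) * (K + 4 * INR (length l))).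
Proof.
  intros Hg Hs Hls Hnd Hga Hr0 Hmean HR Hz Hm. pose proof two_PI_pos as HP.
  assert (Hl1 : List.Forall (fun a => Cmod a < 1) l).
  { apply List.Forall_forall. intros a Ha. specialize (Hls a Ha). lra. }
  assert (Hsub : forall a l' w, Permutation l (a :: l') -> Cmod w <= 1 -> Cmod (blaschke l' w) <= 1).
  { intros a l' w Hp Hw. apply blaschke_le_1; [|exact Hw].
    pose proof (Permutation_Forall Hp Hl1) as H. now inversion_clear H. }
  destruct (blaschke_interpolation l g 4 Hl1 Hnd ltac:(lra) Hga) as [W (W1 & W2 & W3)].
  set (n := INR (length l)) in *.
  destruct (blaschke_near_circle l Hl1) as [c [Hc Hnear]].
  (* The four entries ensure, in turn: the mean bound for [g], [|B| >= 1/2] on the circle, all zeros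
     inside it, and distance at least [(1 - Rr) / 2] from [z]. The last and the 1/2 give
     [4 / (1 - Rr)]; [r'] makes the inequalities strict. *)
  set (r := Rmax (Rmax r0 (1 - 1 / (2 * (c + 1)))) (Rmax s ((1 + Rr) / 2))).
  set (r' := (r + 1) / 2).
  assert (Hc1 : 0 < 1 / (2 * (c + 1))) by (apply Rdiv_lt_0_compat; lra).
  assert (Hr : r < 1) by (unfold r; repeat apply Rmax_lub_lt; lra).
  assert (B1 : r0 <= r) by (eapply Rle_trans; [apply Rmax_l|apply Rmax_l]).
  assert (B2 : 1 - 1 / (2 * (c + 1)) <= r) by (eapply Rle_trans; [apply Rmax_r|apply Rmax_l]).
  assert (B3 : s <= r) by (eapply Rle_trans; [apply Rmax_l|apply Rmax_r]).
  assert (B4 : (1 + Rr) / 2 <= r) by (eapply Rle_trans; [apply Rmax_r|apply Rmax_r]).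
  assert (Hr' : r < r' < 1) by (unfold r'; lra).
  destruct (Hmean r' ltac:(lra)) as [I [HI HIK]].
  set (F := fun w => (g w - W w)%C).
  assert (HF : forall w, Cmod w < 1 -> cdiff F w).
  { intros w Hw. apply cdiff_minus; [now apply Hg|now apply W1]. }
  destruct (is_RInt_circle_Cmod F r' HF ltac:(lra)) as [J HJ].
  assert (HJI : J <= I + (2 * PI - 0) * (4 * n)).
  { refine (is_RInt_le _ _ _ _ _ _ _ HJ (is_RInt_plus (V := R_NormedModule) _ _ _ _ _ _ HI
      (is_RInt_const (V := R_NormedModule) 0 (2 * PI) (4 * n))) _); [lra|].
    intros t _. eapply Rle_trans; [apply Cmod_sub_le|]. apply Rplus_le_compat_l.
    replace (4 * n) with (4 * n * 1) by ring. apply W3. intros a l' Hp. apply (Hsub a l'); [exact Hp|].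
    rewrite Cmod_polar, Rabs_right; lra. }
  assert (HFz : Cmod (F z) <= Cmod (blaschke l z) * (r' / (r' - Cmod z) / (1 / 2) * (J / (2 * PI)))).
  { apply schwarz_blaschke; try assumption; try lra.
    - intros a Ha. specialize (Hls a Ha). split; [lra|]. unfold F. rewrite W2 by exact Ha. ring.
    - intros w Hw. specialize (Hnear w ltac:(lra)). rewrite Hw in Hnear.
      assert (c * (1 - r') <= 1 / 2); [|lra].
      apply Rle_trans with (c * (1 / (2 * (c + 1)))).
      + apply Rmult_le_compat_l; lra.
      + replace (c * (1 / (2 * (c + 1)))) with (1 / 2 - 1 / (2 * (c + 1))) by (field; lra). lra. }
  replace (g z) with (W z + F z)%C by (unfold F; ring).
  eapply Rle_trans; [apply Cmod_triangle|]. apply Rplus_le_compat; [now apply W3|].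
  eapply Rle_trans; [exact HFz|]. apply Rmult_le_compat_l; [apply Cmod_ge_0|].
  assert (HJ0 : 0 <= J).
  { replace 0 with ((2 * PI - 0) * 0) by ring.
    refine (is_RInt_le _ _ _ _ _ _ _ (is_RInt_const (V := R_NormedModule) 0 (2 * PI) 0) HJ _); [lra|].
    intros; apply Cmod_ge_0. }
  pose proof (Cmod_ge_0 z) as Hz0.
  apply Rmult_le_compat.
  - repeat apply Rdiv_le_0_compat; lra.
  - apply Rdiv_le_0_compat; assumption.
  - replace (r' / (r' - Cmod z) / (1 / 2)) with (2 * r' * / (r' - Cmod z)) by (field; lra).
    replace (4 / (1 - Rr)) with (2 * / ((1 - Rr) / 2)) by (field; lra).
    apply Rmult_le_compat; [lra|left; apply Rinv_0_lt_compat; lra|lra|].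
    apply Rinv_le_contravar; lra.
  - apply Rmult_le_reg_l with (2 * PI); [exact HP|].
    replace (2 * PI * (J / (2 * PI))) with J by (field; pose proof PI_neq0; lra). lra.
Qed.

(** The bound [M] certifies that the supremum behind [real] is finite, so that [max_disc] really is
    the least upper bound and not a default value. *)
Lemma max_disc_spec (f : C -> C) (Rr M : R) : 0 <= Rr ->
  (forall z, Cmod z <= Rr -> Cmod (f z) <= M) ->
  (forall z, Cmod z <= Rr -> Cmod (f z) <= max_disc f Rr) /\
  (forall b, (forall z, Cmod z <= Rr -> Cmod (f z) <= b) -> max_disc f Rr <= b).
Proof.
  intros HR HM. unfold max_disc.
  set (S := fun x => exists z, Cmod z <= Rr /\ x = Cmod (f z)).
  destruct (Lub_Rbar_correct S) as [L1 L2].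
  assert (G : Rbar_le (Lub_Rbar S) M).
  { apply (L2 (Finite M)). intros x [z [Hz ->]]. now apply HM. }
  assert (G0 : Rbar_le (Cmod (f 0%C)) (Lub_Rbar S)).
  { apply L1. exists 0%C. split; [rewrite Cmod_0; exact HR|reflexivity]. }
  destruct (Lub_Rbar S) as [x| |]; simpl in *; try contradiction.
  split.
  - intros z Hz. apply (L1 (Cmod (f z))). now exists z.
  - intros b Hb. apply (L2 (Finite b)). intros y [z [Hz ->]]. now apply Hb.
Qed.

Lemma real_point_avoiding (l : list C) (e : R) : 0 < e -> exists x : R, 0 < x <= e /\ ~ In (RtoC x) l.
Proof.
  intros He.
  assert (H : exists d, 0 < d <= e /\ forall x, 0 < x <= d -> ~ In (RtoC x) l).
  { induction l as [|a l [d [Hd IH]]]; [exists e; split; [lra|intros x _ []]|].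
    destruct (classic (a = RtoC (fst a) /\ 0 < fst a)) as [[Ha Ha0]|Ha].
    - pose proof (Rmin_l d (fst a / 2)). pose proof (Rmin_r d (fst a / 2)).
      assert (0 < Rmin d (fst a / 2)) by (apply Rmin_pos; lra).
      exists (Rmin d (fst a / 2)). split; [lra|].
      intros x Hx [Hin|Hin]; [|apply (IH x); [lra|exact Hin]].
      rewrite Hin in *. simpl in *. lra.
    - exists d. split; [exact Hd|]. intros x Hx [Hin|Hin]; [|now apply (IH x)].
      apply Ha. rewrite Hin. simpl. split; [reflexivity|lra]. }
  destruct H as [d [Hd H]]. exists d. split; [lra|]. apply H. lra.
Qed.

(** With [v = u ^ 4], Bernoulli's inequality gives [u ^ n <= 1 / (n d)] for [d = 1 / u - 1]; the
    fourth power beats [n ^ 3] by one factor [n]. *)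
Lemma cube_pow_small (v eta : R) : 0 <= v < 1 -> 0 < eta ->
  exists N, forall n, (N <= n)%nat -> INR n ^ 3 * v ^ n <= eta.
Proof.
  intros Hv He.
  destruct (Req_dec v 0) as [->|Hv0].
  { exists 1%nat. intros n Hn. rewrite pow_i by lia. lra. }
  set (u := sqrt (sqrt v)).
  assert (Hu4 : u ^ 4 = v).
  { replace (u ^ 4) with ((u * u) * (u * u)) by ring. unfold u.
    rewrite (sqrt_sqrt (sqrt v)) by apply sqrt_pos. apply sqrt_sqrt. lra. }
  assert (Hu0 : 0 < u) by (unfold u; repeat apply sqrt_lt_R0; lra).
  assert (Hu1 : u < 1).
  { apply Rnot_le_lt; intros Hc. pose proof (pow_R1_Rle u 4 Hc). lra. }
  set (d := / u - 1).
  assert (Hd : 0 < d).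
  { unfold d. apply Rlt_0_minus. rewrite <- Rinv_1. apply Rinv_lt_contravar; lra. }
  assert (Hd4 : 0 < d ^ 4) by now apply pow_lt.
  assert (Hpow : forall n, (1 <= n)%nat -> u ^ n <= / (INR n * d)).
  { intros n Hn. assert (Hn0 : 0 < INR n) by (apply lt_0_INR; lia).
    replace u with (/ (1 + d)) by (unfold d; field; lra).
    rewrite pow_inv. apply Rinv_le_contravar; [nra|].
    pose proof (poly n d Hd). lra. }
  destruct (INR_unbounded (/ (eta * d ^ 4))) as [N HN].
  exists (Nat.max N 1). intros n Hn.
  assert (Hn0 : 0 < INR n) by (apply lt_0_INR; lia).
  rewrite <- Hu4, <- pow_mult, Nat.mul_comm, pow_mult.
  apply Rle_trans with (INR n ^ 3 * (/ (INR n * d)) ^ 4).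
  - apply Rmult_le_compat_l; [apply pow_le; lra|]. apply pow_incr.
    split; [apply pow_le; lra|apply Hpow; lia].
  - replace (INR n ^ 3 * (/ (INR n * d)) ^ 4) with (/ INR n * / d ^ 4) by (field; lra).
    assert (HNn : / (eta * d ^ 4) < INR n).
    { eapply Rlt_le_trans; [exact HN|]. apply le_INR. lia. }
    apply Rmult_le_reg_r with (d ^ 4); [exact Hd4|].
    rewrite Rmult_assoc, Rinv_l, Rmult_1_r by lra.
    rewrite <- (Rinv_inv (eta * d ^ 4)). apply Rinv_le_contravar; [|lra].
    apply Rinv_0_lt_compat. nra.
Qed.

(* [y] stands for [sqrt M], [m] for the maximum of the [|B_a z|]. *)
Lemma extrapolation_balance (n y c K Rr m : R) :
  1 <= n -> 0 < y -> 0 < c -> 0 < K -> 0 < Rr < 1 ->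
  4096 * c ^ 3 * (n ^ 3 * y) <= 1 -> 128 * c * (n ^ 3 * y) <= Rr ->
  8 * (K + 4) / (1 - Rr) * (n ^ 3 * y) <= 1 ->
  (forall t, 0 < t -> 8 * t <= Rr -> m <= c * (y ^ 2 / t + t ^ 2)) ->
  4 * n * m + y ^ 2 * (4 / (1 - Rr) * (K + 4 * n)) <= y.
Proof.
  intros Hn Hy Hc HK HR C1 C2 C3 Hm.
  assert (Hn3 : n <= n ^ 3).
  { assert (1 <= n ^ 2) by nra. replace (n ^ 3) with (n * n ^ 2) by ring. nra. }
  assert (Hny : n * y <= n ^ 3 * y) by (apply Rmult_le_compat_r; lra).
  (* Chosen so that the term [4 n c y ^ 2 / t] equals [y / 4]; the first smallness condition then
     bounds [4 n c t ^ 2] by [y / 4] as well. *)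
  set (t := 16 * n * c * y).
  assert (Hnc : 0 < n * c) by (apply Rmult_lt_0_compat; lra).
  assert (Ht : 0 < t) by (unfold t; nra).
  assert (HtR : 8 * t <= Rr).
  { unfold t. replace (8 * (16 * n * c * y)) with (128 * c * (n * y)) by ring.
    eapply Rle_trans; [|exact C2]. apply Rmult_le_compat_l; lra. }
  specialize (Hm t Ht HtR).
  assert (E1 : 4 * n * (c * (y ^ 2 / t + t ^ 2)) = y / 4 + y * (4096 * c ^ 3 * (n ^ 3 * y)) / 4).
  { unfold t. field. lra. }
  assert (H1 : 4 * n * m <= y / 2).
  { apply Rle_trans with (4 * n * (c * (y ^ 2 / t + t ^ 2))).
    - apply Rmult_le_compat_l; lra.
    - rewrite E1. assert (y * (4096 * c ^ 3 * (n ^ 3 * y)) <= y * 1) by (apply Rmult_le_compat_l; lra).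
      lra. }
  assert (Hi : 0 < / (1 - Rr)) by (apply Rinv_0_lt_compat; lra).
  assert (H2 : y ^ 2 * (4 / (1 - Rr) * (K + 4 * n)) <= y / 2).
  { apply Rle_trans with (y / 2 * (8 * (K + 4) / (1 - Rr) * (n ^ 3 * y))); [|nra].
    replace (y ^ 2 * (4 / (1 - Rr) * (K + 4 * n)))
      with (y / 2 * (8 / (1 - Rr)) * ((K + 4 * n) * y)) by (field; lra).
    replace (y / 2 * (8 * (K + 4) / (1 - Rr) * (n ^ 3 * y)))
      with (y / 2 * (8 / (1 - Rr)) * ((K + 4) * (n ^ 3 * y))) by (field; lra).
    apply Rmult_le_compat_l.
    - unfold Rdiv. apply Rmult_le_pos; nra.
    - assert ((K + 4 * n) * y <= (K + 4) * (n * y)) by nra. nra. }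
  lra.
Qed.

Theorem theorem1p3 :
  forall (p : Rbar) (Rr : R), valid_exp p -> 0 < Rr < 1 ->
  exists Cst : R, 0 < Cst /\
  forall E : C -> Prop,
    (forall z, E z -> in_U z) ->
    infinite_set E ->
    (forall z, closure_C E z -> in_U z) ->
    exists eps0 : R, 0 < eps0 /\
    forall eps : R, 0 < eps < eps0 ->
    exists zs : list C,
      (forall a, In a zs -> closure_C E a) /\
      Rbar_le (Finite (max_disc (blaschke zs) Rr)) (Cp p E eps Rr) /\
      Rbar_le (Cp p E eps Rr) (Finite (Cst * sqrt (max_disc (blaschke zs) Rr))) /\
      (forall z, E z -> Cmod (blaschke zs z) <= eps).
Proof.
  intros p Rr Hp HR. destruct (unit_ball_mean_bound p Hp) as [K [HK Hmean]].
  exists 1. split; [lra|]. intros E HU HE Hcl.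
  destruct (closure_in_disc_radius E HU Hcl) as [s [Hs HEs]].
  set (w := sqrt (1 - (1 - s ^ 2) * (1 - Rr ^ 2) / 4)).
  assert (Hw : 0 <= w < 1) by now apply bfactor_bound_lt_1.
  set (c := 12 + 256 / (1 - Rr) ^ 3).
  assert (Hc0 : 0 < 256 / (1 - Rr) ^ 3) by (apply Rdiv_lt_0_compat; [|apply pow_lt]; lra).
  assert (Hc : 0 < c) by (unfold c; lra).
  assert (Hv : 0 <= sqrt w < 1).
  { split; [apply sqrt_pos|]. apply Rlt_le_trans with (sqrt 1); [now apply sqrt_lt_1_alt|].
    rewrite sqrt_1. lra. }
  (* One entry for each smallness condition of [extrapolation_balance]. *)
  set (eta := Rmin (/ (4096 * c ^ 3)) (Rmin (Rr / (128 * c)) (/ (8 * (K + 4) / (1 - Rr))))).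
  assert (Hc3 : 0 < 4096 * c ^ 3) by (apply Rmult_lt_0_compat; [lra|now apply pow_lt]).
  assert (HK8 : 0 < 8 * (K + 4) / (1 - Rr)) by (apply Rdiv_lt_0_compat; lra).
  assert (Heta : 0 < eta).
  { repeat apply Rmin_pos; [now apply Rinv_0_lt_compat|apply Rdiv_lt_0_compat; lra|
      now apply Rinv_0_lt_compat]. }
  assert (Eta1 : eta <= / (4096 * c ^ 3)) by apply Rmin_l.
  assert (Eta2 : eta <= Rr / (128 * c)) by (eapply Rle_trans; [apply Rmin_r|apply Rmin_l]).
  assert (Eta3 : eta <= / (8 * (K + 4) / (1 - Rr)))
    by (eapply Rle_trans; [apply Rmin_r|apply Rmin_r]).
  (* The base is [sqrt w] because [M <= w ^ n] is used through [sqrt M]. Asking for [S N] points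
     below also makes the list nonempty. *)
  destruct (cube_pow_small (sqrt w) eta Hv Heta) as [N HN].
  destruct (blaschke_selection E s (S N) HEs Hs HE) as [eps0 [Heps0 Hsel]].
  exists eps0. split; [exact Heps0|]. intros eps Heps.
  destruct (Hsel eps Heps) as [l (Hlen & Hnd & HlE & Hle & Hlow)].
  assert (Hl1 : List.Forall (fun a => Cmod a < 1) l).
  { apply List.Forall_forall. intros a Ha. apply HU, HlE, Ha. }
  destruct (max_disc_spec (blaschke l) Rr 1 ltac:(lra)) as [HM1 HM2].
  { intros z Hz. apply blaschke_le_1; [exact Hl1|lra]. }
  set (M := max_disc (blaschke l) Rr) in *.
  exists l. split; [|split; [|split; [|exact Hle]]].
  - intros a Ha d Hd. exists a. split; [now apply HlE|].
    replace (a - a)%C with (RtoC 0) by ring. now rewrite Cmod_0.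
  - destruct (Lub_Rbar_correct (fun x => exists g : C -> C,
      Hp_unit_ball p g /\ (forall w, E w -> Cmod (g w) <= eps) /\
      exists z : C, Cmod z <= Rr /\ x = Cmod (g z))) as [L1 _].
    fold (Cp p E eps Rr) in L1.
    assert (HL : forall z, Cmod z <= Rr -> Rbar_le (Cmod (blaschke l z)) (Cp p E eps Rr)).
    { intros z Hz. apply L1. exists (blaschke l). split; [now apply blaschke_unit_ball|].
      split; [exact Hle|]. now exists z. }
    destruct (Cp p E eps Rr) as [x| |]; simpl in *.
    + now apply HM2.
    + exact I.
    + apply (HL 0%C). rewrite Cmod_0. lra.
  - rewrite Rmult_1_l.
    (* The step [t] is proportional to [sqrt M], so [M] must not vanish; a real point of the disc
       that is not a zero witnesses this. *)
    assert (HMpos : 0 < M).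
    { destruct (real_point_avoiding l Rr ltac:(lra)) as [x [Hx Hin]].
      assert (Hxm : Cmod (RtoC x) = x) by (rewrite Cmod_R, Rabs_right; lra).
      apply Rlt_le_trans with (Cmod (blaschke l (RtoC x))); [|apply HM1; lra].
      apply Cmod_gt_0. intros E0. apply Hin. apply (blaschke_eq_0 l); [exact Hl1|lra|exact E0]. }
    assert (HMw : M <= w ^ length l).
    { apply HM2. intros z Hz. apply blaschke_le_pow. intros a Ha.
      apply bfactor_le; try lra. apply HEs, HlE, Ha. }
    set (y := sqrt M). assert (Hy : 0 < y) by now apply sqrt_lt_R0.
    assert (Hy2 : y ^ 2 = M) by (unfold y; apply pow2_sqrt; lra).
    assert (Hyv : y <= sqrt w ^ length l).
    { apply Rsqr_incr_0_var; [|apply pow_le, sqrt_pos].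
      replace (Rsqr y) with (y ^ 2) by (unfold Rsqr; ring).
      replace (Rsqr (sqrt w ^ length l)) with (w ^ length l).
      - rewrite Hy2. exact HMw.
      - unfold Rsqr. rewrite <- Rpow_mult_distr, sqrt_sqrt by lra. reflexivity. }
    set (n := INR (length l)).
    assert (Hn : 1 <= n).
    { unfold n. change 1 with (INR 1). apply le_INR. lia. }
    assert (Hny : n ^ 3 * y <= eta).
    { eapply Rle_trans; [|apply (HN (length l)); lia].
      apply Rmult_le_compat_l; [apply pow_le, pos_INR|exact Hyv]. }
    apply (proj2 (Lub_Rbar_correct _) (Finite y)).
    intros x [g [Hg [Hge [z [Hz ->]]]]]. simpl.
    assert (Hgd : forall u, Cmod u < 1 -> cdiff g u).
    { intros u Hu. apply ex_derive_cdiff, (proj1 Hg), Hu. }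
    destruct (Hmean g Hg) as [r0 [Hr0 Hgm]].
    assert (Hrem : forall a l' t, Permutation l (a :: l') -> 0 < t -> 8 * t <= Rr ->
      Cmod (blaschke l' z) <= c * (y ^ 2 / t + t ^ 2)).
    { intros a l' t Hpa Ht HtR.
      pose proof (Permutation_Forall Hpa Hl1) as Hpl. inversion_clear Hpl as [|? ? Ha Hl'].
      eapply Rle_trans.
      - apply (remove_bfactor (blaschke l') Rr M t a z); try assumption; try lra.
        + intros u Hu. apply blaschke_cdiff; [exact Hl'|lra].
        + intros u Hu. apply blaschke_le_1; [exact Hl'|lra].
        + intros u Hu. rewrite <- blaschke_cons, <- (blaschke_perm _ _ u Hpa). now apply HM1.
      - rewrite Hy2. unfold c.
        assert (0 <= M / t) by (left; now apply Rdiv_lt_0_compat).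
        assert (0 <= t ^ 2) by apply pow2_ge_0.
        set (q := 256 / (1 - Rr) ^ 3) in *.
        assert (0 <= q * (M / t)) by (apply Rmult_le_pos; lra). lra. }
    (* A single [m] has to work for all removed zeros and all [t]. The supremum does, since each
       bound in [t] holds for all removals and hence for their supremum; [t = Rr / 8] shows that it
       is finite. *)
    assert (Hmm : exists m, (forall a l', Permutation l (a :: l') -> Cmod (blaschke l' z) <= m) /\
      forall t, 0 < t -> 8 * t <= Rr -> m <= c * (y ^ 2 / t + t ^ 2)).
    { destruct (completeness (fun x => exists a l', Permutation l (a :: l') /\ x = Cmod (blaschke l' z)))
        as [m [Hm1 Hm2]].
      - exists (c * (y ^ 2 / (Rr / 8) + (Rr / 8) ^ 2)). intros x [a [l' [Hpa ->]]].
        apply (Hrem a); [exact Hpa|lra|lra].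
      - destruct l as [|a l']; [simpl in Hlen; lia|].
        exists (Cmod (blaschke l' z)), a, l'. split; reflexivity.
      - exists m. split.
        + intros a l' Hpa. apply Hm1. now exists a, l'.
        + intros t Ht HtR. apply Hm2. intros x [a [l' [Hpa ->]]]. now apply (Hrem a). }
    destruct Hmm as [m [Hm1 Hm2]].
    eapply Rle_trans.
    { apply (interpolation_estimate g l K Rr r0 s m z); try assumption; try lra.
      - intros a Ha. apply HEs, HlE, Ha.
      - intros a l' Hpa. specialize (Hlow a l' Hpa).
        assert (HaE : E a).
        { apply HlE. apply (Permutation_in a (Permutation_sym Hpa)). now left. }
        specialize (Hge a HaE). lra. }
    fold n. apply Rle_trans with (4 * n * m + y ^ 2 * (4 / (1 - Rr) * (K + 4 * n))).
    { apply Rplus_le_compat_l. rewrite Hy2. apply Rmult_le_compat_r; [|now apply HM1].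
      apply Rmult_le_pos; [left; apply Rdiv_lt_0_compat; lra|lra]. }
    apply (extrapolation_balance n y c K Rr m); try assumption.
    + apply Rle_trans with (4096 * c ^ 3 * / (4096 * c ^ 3)).
      * apply Rmult_le_compat_l; lra.
      * rewrite Rinv_r; lra.
    + apply Rle_trans with (128 * c * (Rr / (128 * c))).
      * apply Rmult_le_compat_l; lra.
      * apply Req_le. field. lra.
    + apply Rle_trans with (8 * (K + 4) / (1 - Rr) * / (8 * (K + 4) / (1 - Rr))).
      * apply Rmult_le_compat_l; lra.
      * rewrite Rinv_r; lra.
Qed.
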